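(* Let $S=R\cap\mathbb{Z}^n$ for some rational polyhedron $R\subseteq\mathbb{R}^n$, and let $P\subseteq\operatorname{conv}(S)$ be a nonempty rational polyhedron (so $S$ is nonempty). Then the $S$-Chvátal-Gomory closure $P_S$ of $P$ is a rational polyhedron.
   Context: For $S\subseteq\mathbb{Z}^n$, $\alpha\in\mathbb{Z}^n$ (row vector), $\beta\in\mathbb{R}$, if some $x\in S$ satisfies $\alpha x\le\beta$, set $\lfloor\beta\rfloor_{S,\alpha}=\max\{\alpha x: x\in S,\ \alpha x\le\beta\}$. The $S$-CG cut from $\alpha x\le\beta$ is $\alpha x\le\lfloor\beta\rfloor_{S,\alpha}$; if no point of $S$ satisfies $\alpha x\le\beta$, the $S$-CG cut is $\mathbf{0}x\le-1$, i.e. the set $\{x:\alpha x\le\lfloor\beta\rfloor_{S,\alpha}\}$ is understood to be empty. For a nonempty rational polyhedron $P=\{x\in\mathbb{R}^n: Ax\le b\}$ with $A\in\mathbb{Z}^{m\times n}$, $b\in\mathbb{Z}^m$, let $$\Pi_P=\{(\lambda A,\lambda b)\in\mathbb{Z}^n\times\mathbb{R}:\ \lambda\in\mathbb{R}^m_+,\ \lambda b=\max\{\lambda Ax: x\in P\}\}.$$ The $S$-CG closure of $P$ is $P_S=\bigcap_{(\alpha,\beta)\in\Pi_P}\{x\in\mathbb{R}^n:\alpha x\le\lfloor\beta\rfloor_{S,\alpha}\}$. *)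

(* Defs.v *)
From mathcomp Require Import all_boot all_order all_algebra.
From mathcomp Require Import boolp classical_sets reals convex.

Set Implicit Arguments.
Unset Strict Implicit.
Unset Printing Implicit Defensive.

Import Order.TTheory GRing.Theory Num.Theory.

Local Open Scope classical_set_scope.
Local Open Scope ring_scope.

Notation toReal R A := (map_mx (intmul 1 : int -> R) A).

Section Polyhedra.
Variables (R : realType) (n : nat).

Definition polyhedron m (A : 'M[int]_(m, n)) (b : 'cV[int]_m) : set 'cV[R]_n :=
  [set x | forall i, (toReal R A *m x) i 0 <= (b i 0)%:~R].

(* Integral data lose no generality: a rational row can be cleared of its
   denominators. The empty set and the whole space are allowed. *)
Definition rational_polyhedron (Q : set 'cV[R]_n) : Prop :=
  exists m (A : 'M[int]_(m, n)) (b : 'cV[int]_m), Q = polyhedron A b.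

Definition integer_points (Q : set 'cV[R]_n) : set 'cV[int]_n :=
  [set z | Q (toReal R z)].

Definition convex_hull (S : set 'cV[int]_n) : set 'cV[R]_n :=
  smallest (@convex_set R 'cV[R]_n) [set toReal R z | z in S].

End Polyhedra.

(* The set of maxima of E; it has at most one element. *)
Definition maxima d (T : orderType d) (E : set T) : set T := E `&` ubound E.

Section SCG.
Variables (R : realType) (n : nat).

Definition S_values (S : set 'cV[int]_n) (alpha : 'rV[int]_n) (beta : R) :
    set int :=
  [set (alpha *m z) 0 0 | z in
    [set z | S z /\ ((alpha *m z) 0 0)%:~R <= beta]].

(* When S_values is nonempty, it is a set of integers bounded above by beta,
   so the maximum exists; otherwise the value 0 is a dummy. *)
Definition S_floor (S : set 'cV[int]_n) (alpha : 'rV[int]_n) (beta : R) : int :=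
  xget 0 (maxima (S_values S alpha beta)).

(* Empty when no point of S satisfies alpha z <= beta. *)
Definition SCG_cut (S : set 'cV[int]_n) (alpha : 'rV[int]_n) (beta : R) :
    set 'cV[R]_n :=
  [set x | S_values S alpha beta !=set0 /\
           (toReal R alpha *m x) 0 0 <= (S_floor S alpha beta)%:~R].

Definition Pi m (A : 'M[int]_(m, n)) (b : 'cV[int]_m) : set ('rV[int]_n * R) :=
  [set p | exists lambda : 'rV[R]_m,
     [/\ forall i, 0 <= lambda 0 i,
         toReal R p.1 = lambda *m toReal R A,
         p.2 = (lambda *m toReal R b) 0 0 &
         maxima [set (lambda *m toReal R A *m x) 0 0 | x in polyhedron A b]
                p.2]].

Definition SCG_closure (S : set 'cV[int]_n) m (A : 'M[int]_(m, n))
    (b : 'cV[int]_m) : set 'cV[R]_n :=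
  \bigcap_(p in Pi A b) SCG_cut S p.1 p.2.

End SCG.

Arguments polyhedron R {n m} A b.
Arguments convex_hull R {n} S.
Arguments Pi R {n m} A b.
Arguments SCG_closure R {n} S {m} A b.

(* Main.v *)
Require Import Defs.
From mathcomp Require Import all_boot all_order all_algebra.
From mathcomp Require Import boolp classical_sets reals convex.
From mathcomp Require Import filter ring lra zify.

Set Implicit Arguments.
Unset Strict Implicit.
Unset Printing Implicit Defensive.

Import Order.TTheory GRing.Theory Num.Theory.

Local Open Scope classical_set_scope.
Local Open Scope ring_scope.

(** Let P be the polyhedron A x <= b. By complementary slackness, a pair of Pi
comes from a multiplier lambda >= 0 supported on a set T of rows that are all
tight at some point of P, and lambda can be taken rational
([rational_multipliers]). Call lambda (b - A z) the defect of z. The cut given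
by lambda says that the vector y of the slacks b_i - A_i x, i in T, satisfies
lambda y >= s as soon as no point of S has its defect in [0, s[; such a pair
(lambda, s) is called gap-free. There are finitely many sets T, so the theorem
reduces ([SCG_closureE]) to one T: the set of all y that satisfy every
gap-free inequality is a rational polyhedron ([gap_region_finite]). Since S is
a finite set plus a finitely generated monoid
([integer_points_decomposition]), the defects are the numbers
c_a(lambda) - sum_j mu_j d_j(lambda), where a ranges over a finite set, mu over
natural vectors, and the c_a and d_j are integer linear functionals.

Finitely many cuts need not suffice (already when S is finite, the multipliers
that share the same best point of S form a cone that need not be closed). What
suffices is finitely many valid inequalities, some of them limits of cuts.
Their existence is a compactness statement: if no finite set of valid
inequalities implied all gap-free ones, an ultrafilter on the gap-free pairs
would avoid, for each finite set F of valid inequalities, the pairs that F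
implies ([ultra_cover]). So it is enough to find, for each ultrafilter U, a
finite F that implies U-almost every pair. Along U every sign is constant, and
every integer quantity is constant or tends to an infinity.

- If the pairs are bounded and the signs of finitely many affine forms decide
  gap-freeness, the pairs with the signs seen by U fill a half-open polytope;
  the vertices of its closure are limits of gap-free pairs, hence valid, and
  they imply everything inside ([tame_bounded]). The remaining cases are
  reduced to this one by rescaling, because gap-freeness is homogeneous, and by
  decreasing lambda, because y >= 0.
- If some d_j(lambda) is positive and another one negative, lambda can be
  rescaled so that the sums of the mu_j d_j(lambda) are exactly the integers.
  Replacing lambda by its fractional part shifts all defects by integers, and
  so preserves gap-freeness ([tame_mixed]).
- If the nonzero d_j(lambda) have the same sign eps, rescale so that the
  smallest |d_j(lambda)| is 1, which forces s <= 1. Write lambda as its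
  fractional part plus an integer vector h, and replace h by a fixed value h0
  that it takes along U. A defect that became too small by an integer is
  compensated by that many copies of the generator with |d_j(lambda)| = 1; this
  fails only for points of S whose defect at h tends to the wrong infinity. By
  Dickson's lemma, finitely many of them control all the others, and a
  suitable h0 moves these already out of reach ([tame_directed]).
- Otherwise all d_j(lambda) vanish, or adding generators only increases defects
  that are nonnegative from the start. Then only the finitely many c_a matter,
  and the sum of the entries of lambda can be rescaled to 1
  ([tame_bounded_below]). *)

(** * Ultrafilters and compactness *)

Section Ultrafilters.
Variables (X : Type) (U : set_system X).
Context {UU : UltraFilter U}.

Lemma near_false : (\forall x \near U, False) -> False.
Proof. exact: filter_not_empty. Qed.

Lemma ultra_em (P : X -> Prop) :
  (\forall x \near U, P x) \/ (\forall x \near U, ~ P x).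
Proof. exact: in_ultra_setVsetC. Qed.

Lemma ultra_finite (I : finType) (P : I -> X -> Prop) :
  (\forall x \near U, exists i, P i x) -> exists i, \forall x \near U, P i x.
Proof.
move=> UP; apply: contrapT => noi.
have {}noi i : \forall x \near U, ~ P i x.
  by have [UPi|//] := ultra_em (P i); case: noi; exists i.
have {}noi : \forall x \near U, forall i, ~ P i x by exact: filter_forall.
by apply: near_false; apply: filterS2 UP noi => x [i Pix] /(_ i).
Qed.

Lemma ultra_set (I : finType) (P : I -> X -> bool) :
  exists J : {set I}, \forall x \near U, forall i, (i \in J) = P i x.
Proof.
exists [set i | `[< \forall x \near U, P i x >]]%SET.
apply: filter_forall => i; rewrite inE.
have [PU|nPU] := ultra_em (fun x => P i x).
  by apply: filterS (PU) => x ->; apply/asboolP.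
apply: filterS (nPU) => x /negP/negbTE->; apply/asboolPn => PU.
by apply: near_false; apply: filterS2 nPU PU.
Qed.

Lemma ultra_int_bounded (f : X -> int) (N : int) :
  (\forall x \near U, `|f x| <= N) -> exists c, \forall x \near U, f x = c.
Proof.
move=> bf.
have [|i fi] := @ultra_finite 'I_((absz N).*2.+1)
    (fun i x => f x = (i : nat)%:Z - N).
  apply: filterS bf => x fxN.
  have lt_i : (absz (f x + N)%R < (absz N).*2.+1)%N by lia.
  by exists (Ordinal lt_i) => /=; lia.
by exists ((i : nat)%:Z - N).
Qed.

Definition tends_up (f : X -> int) := forall N, \forall x \near U, N <= f x.

Lemma ultra_int_trichotomy (f : X -> int) :
  [\/ exists c, \forall x \near U, f x = c,
      tends_up f | tends_up (fun x => - f x)].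
Proof.
have [fU|/existsNP[N fN]] := pselect (tends_up f); first by constructor 2.
have [fU|/existsNP[N' fN']] := pselect (tends_up (fun x => - f x)).
  by constructor 3.
constructor 1; apply: (@ultra_int_bounded _ (Num.max `|N| `|N'|)).
have [//|{}fN] := ultra_em (fun x => N <= f x).
have [//|{}fN'] := ultra_em (fun x => N' <= - f x).
by apply: filterS2 fN fN' => x; lia.
Qed.

End Ultrafilters.

Lemma near_in_seq (T : eqType) (X : Type) (U : set_system X) (F : seq T)
    (P : T -> X -> Prop) : Filter U ->
  (forall t, t \in F -> \forall x \near U, P t x) ->
  \forall x \near U, forall t, t \in F -> P t x.
Proof.
move=> FU; elim: F => [|t F IHF] FP; first by apply: nearW.
have Pt := FP t (mem_head t F).
have PF : \forall x \near U, forall t, t \in F -> P t x.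
  by apply: IHF => t' t'F; apply: FP; rewrite inE t'F orbT.
apply: filterS2 Pt PF => x Ptx PFx t'; rewrite inE => /orP[/eqP->//|]; exact: PFx.
Qed.

(** Compactness in contrapositive form: if no member of C covered G, the sets
[G `\` A] would generate a proper filter, and an ultrafilter above it would
contain no member of C. *)
Lemma ultra_cover (X : Type) (G : set X) (C : set (set X)) :
    C !=set0 ->
    (forall A B, C A -> C B -> exists2 D, C D & A `|` B `<=` D) ->
    (forall U, UltraFilter U -> U G -> exists2 A, C A & U A) ->
  exists2 A, C A & G `<=` A.
Proof.
move=> [A0 CA0] CU UC; apply: contrapT => noA.
have FF : ProperFilter (filter_from C (fun A => G `\` A)).
  apply: filter_from_proper.
    apply: filter_from_filter; first by exists A0.
    move=> A B CA CB; have [D CD ABD] := CU A B CA CB; exists D => // x [Gx nDx].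
    by split; split=> // ?; apply: nDx; apply: ABD; [left|right].
  move=> A CA; apply: contrapT => GA0; apply: noA; exists A => // x Gx.
  by apply: contrapT => nAx; apply: GA0; exists x.
have [U [UU FU]] := ultraFilterLemma FF.
have [|A CA UA] := UC U UU; first by apply: FU; exists A0 => // x [].
have UnA : U (G `\` A) by apply: FU; exists A.
by apply: (@near_false _ U); apply: filterS2 UA UnA => x Ax [_]; apply.
Qed.

(** Dickson's lemma, pulled back along the coordinates f: along an ultrafilter
each coordinate is constant or tends to infinity, so almost every point of G
lies below almost all others. *)
Lemma dickson (I : finType) (X : eqType) (f : I -> X -> nat) (G : set X) :
  exists2 F : seq X, {in F, forall y, G y} &
    forall x, G x -> exists2 y, y \in F & forall i, (f i y <= f i x)%N.
Proof.
pose up (F : seq X) := [set x | exists2 y, y \in F & forall i, (f i y <= f i x)%N].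
pose C := [set A | exists2 F : seq X, {in F, forall y, G y} & A = up F].
have [||U UU UG|A [F FG ->] GA] := @ultra_cover X G C.
- by exists (up [::]); exists [::].
- move=> _ _ [F FG ->] [F' F'G ->]; exists (up (F ++ F')).
    by exists (F ++ F') => // y; rewrite mem_cat => /orP[/FG|/F'G].
  by move=> x [[y yF yx]|[y yF yx]]; exists y; rewrite // mem_cat yF ?orbT.
- have Umin i : \forall y \near U, \forall x \near U, (f i y <= f i x)%N.
    have [[c fc]|fU|fU] := ultra_int_trichotomy (fun x => (f i x)%:Z).
    + apply: filterS (fc) => y fy; apply: filterS fc => x fx.
      by rewrite -lez_nat fx fy.
    + by apply: nearW => y; apply: filterS (fU (f i y)) => x; rewrite lez_nat.
    + by exfalso; apply: (@near_false _ U); apply: filterS (fU 1) => x; lia.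
  have {}Umin : \forall y \near U, forall i, \forall x \near U, (f i y <= f i x)%N.
    exact: filter_forall.
  have [x0 [Gx0 x0min]] := filter_ex (filterI UG Umin).
  exists (up [:: x0]).
    by exists [:: x0] => // y; rewrite inE => /eqP->.
  have : \forall x \near U, forall i, (f i x0 <= f i x)%N by exact: filter_forall.
  by apply: filterS => x fx; exists x0; rewrite ?inE.
- by exists F.
Qed.

(** * Polytopes are generated by finitely many points *)

Section PolytopeHull.
Variables (F : realFieldType) (V : lmodType F) (I : finType).
Variable phi : I -> V -> F.
(* Affinity is only required along lines, which spares a bundled type of
   affine maps. *)
Hypothesis phi_affine : forall i x y t,
  phi i (x + t *: (y - x)) = phi i x + t * (phi i y - phi i x).
(* Some constraint decreases along every direction, so that no ray stays in the
   polyhedron. *)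
Hypothesis phi_bounded : forall x y, x != y -> exists i, phi i y < phi i x.

Let K x := forall i, 0 <= phi i x.
Let tight x := [set i | phi i x == 0]%SET.

(** Moving from x towards y keeps the constraints tight at x tight, and the first
constraint that would be violated becomes tight. *)
Lemma polytope_exit x y : K x -> tight x \subset tight y -> x != y ->
  exists2 t, 0 < t & let z := x + t *: (y - x) in K z /\ tight x \proper tight z.
Proof.
move=> Kx xy neq_xy; have [i0 yx0] := phi_bounded neq_xy.
pose r i := phi i x / (phi i x - phi i y).
have [i yxi rmin] := @arg_minP _ _ _ i0 (fun i => phi i y < phi i x) r yx0.
have xi_gt0 : 0 < phi i x.
  rewrite lt_neqAle Kx andbT eq_sym; apply/eqP => xi0.
  have /(fintype.subsetP xy) : i \in tight x by rewrite inE xi0.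
  by rewrite inE => /eqP yi0; move: yxi; rewrite xi0 yi0 ltxx.
exists (r i) => /=; first by rewrite divr_gt0 // subr_gt0.
split=> [j|].
  rewrite phi_affine; have [yxj|xyj] := ltP (phi j y) (phi j x).
    have := rmin j yxj; rewrite {2}/r ler_pdivlMr ?subr_gt0 //; lra.
  rewrite addr_ge0 ?Kx // mulr_ge0 ?subr_ge0 //.
  by rewrite divr_ge0 ?Kx // subr_ge0 ltW.
apply/properP; split.
  apply/fintype.subsetP => j jx; have /(fintype.subsetP xy) := jx.
  by move: jx; rewrite !inE phi_affine => /eqP-> /eqP->; rewrite subrr mulr0 addr0.
exists i; rewrite inE; last by rewrite gt_eqF.
rewrite phi_affine -(opprB (phi i x)) mulrN /r.
by rewrite divfK ?subrr // gt_eqF // subr_gt0.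
Qed.

(** Pick one point of the polytope for each possible tight set. Any other point
with the same tight set lies on the line through the picked one, between two
points with more tight constraints; the proof is by induction on the number of
constraints that are not tight. The convex hull is expressed by quantifying
over the predicates C that are closed under segments. *)
Lemma polytope_hull : exists2 vs : seq V, {in vs, forall v, K v} &
  forall C : V -> Prop,
    (forall x y t, 0 <= t <= 1 -> C x -> C y -> C (x + t *: (y - x))) ->
    {in vs, forall v, C v} -> forall x, K x -> C x.
Proof.
pose rep T := xget 0 [set x | K x /\ tight x = T].
have repP x : K x -> K (rep (tight x)) /\ tight (rep (tight x)) = tight x.
  by move=> Kx; apply: (@xgetPex _ 0 [set y | K y /\ tight y = tight x]); exists x.
exists [seq rep T | T in [pred T : {set I} | `[< K (rep T) >]]].
  by move=> v /mapP[T]; rewrite mem_enum => /asboolP KT ->.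
move=> C Cconv Cvs x.
have [n] := ubnP #|~: tight x|; elim: n x => // n IHn x xn Kx.
have Crep : C (rep (tight x)).
  by apply: Cvs; apply: map_f; rewrite mem_enum; apply/asboolP; have [] := repP x Kx.
have [->//|neq] := eqVneq x (rep (tight x)).
move: Crep (repP x Kx) neq; set p := rep _ => Crep [Kp Tp] neq.
have IH z : K z -> tight x \proper tight z -> C z.
  move=> Kz xz; apply: IHn => //; rewrite -ltnS; apply: leq_trans xn; rewrite ltnS.
  by apply: proper_card; rewrite properC.
have [t t0 []] := polytope_exit Kx (y := p) ltac:(by rewrite Tp) neq.
move=> /IH Ca /Ca{}Ca.
(* The mirror image of p, to leave the polytope in the opposite direction. *)
pose q := x + (-1) *: (p - x).
have neq' : x != q.
  by rewrite -subr_eq0 /q opprD addNKr scaleN1r opprK subr_eq0 eq_sym.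
have Tq : tight x \subset tight q.
  apply/fintype.subsetP => j jx; have : j \in tight p by rewrite Tp.
  by move: jx; rewrite !inE phi_affine => /eqP-> /eqP->; rewrite subrr mulr0 addr0.
have [u u0 []] := polytope_exit Kx Tq neq'.
move=> /IH Cb /Cb{}Cb.
have tu0 : t + u != 0 by rewrite gt_eqF // addr_gt0.
have := Cconv _ _ (t / (t + u)) _ Ca Cb.
have -> : x + t *: (p - x) +
    (t / (t + u)) *: (x + u *: (q - x) - (x + t *: (p - x))) = x.
  have -> : q - x = - (p - x) by rewrite /q addrC addKr scaleN1r.
  rewrite scalerN opprD addrACA subrr add0r -opprD -scalerDl [u + t]addrC.
  by rewrite scalerN scalerA divfK // addrK.
have tu_gt0 := addr_gt0 t0 u0.
apply; rewrite divr_ge0 ?(ltW t0) ?(ltW tu_gt0) //=.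
by rewrite ler_pdivrMr ?addr_gt0 // mul1r lerDl ltW.
Qed.

End PolytopeHull.

(** * Integer functionals on rational and on integer rows *)

Section Pairing.
Variable m : nat.
Implicit Types (u v h : 'rV[int]_m) (l : 'rV[rat]_m).

Definition dot u l : rat := \sum_i l 0 i * (u 0 i)%:~R.

Lemma dotDl u v l : dot (u + v) l = dot u l + dot v l.
Proof. by rewrite -big_split; apply: eq_bigr => i _; rewrite mxE intrD mulrDr. Qed.

Lemma dotNl u l : dot (- u) l = - dot u l.
Proof. by rewrite -sumrN; apply: eq_bigr => i _; rewrite mxE intrN mulrN. Qed.

Lemma dot0l l : dot 0 l = 0.
Proof. by rewrite /dot big1 // => i _; rewrite mxE mulr0. Qed.

Lemma dotDr u l l' : dot u (l + l') = dot u l + dot u l'.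
Proof. by rewrite -big_split; apply: eq_bigr => i _; rewrite mxE mulrDl. Qed.

Lemma dotZr u t l : dot u (t *: l) = t * dot u l.
Proof. by rewrite mulr_sumr; apply: eq_bigr => i _; rewrite mxE mulrA. Qed.

Lemma dotBr u l l' : dot u (l - l') = dot u l - dot u l'.
Proof. by rewrite dotDr -scaleN1r dotZr mulN1r. Qed.

Lemma dot_suml p (d : 'I_p -> 'rV[int]_m) (mu : 'I_p -> nat) l :
  dot (\sum_j d j *+ mu j) l = \sum_j (mu j)%:R * dot (d j) l.
Proof.
transitivity (\sum_j dot (d j *+ mu j) l).
  by apply: (big_morph (dot^~ l)) => [u v|]; rewrite ?dotDl ?dot0l.
apply: eq_bigr => j _; elim: (mu j) => [|k IHk]; first by rewrite mulr0n dot0l mul0r.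
by rewrite mulrSr dotDl IHk -natr1 mulrDl mul1r.
Qed.

Definition idot u h : int := \sum_i h 0 i * u 0 i.

Lemma dot_int u h : dot u (map_mx intr h) = (idot u h)%:~R.
Proof. by rewrite rmorph_sum; apply: eq_bigr => i _; rewrite mxE rmorphM. Qed.

Lemma idot_mx u h :
  (map_mx intr u : 'rV[rat]_m) *m (map_mx intr h)^T = (idot u h)%:~R%:M.
Proof.
apply/rowP => i; rewrite !mxE ord1 eqxx mulr1n rmorph_sum.
by apply: eq_bigr => k _; rewrite !mxE rmorphM /= mulrC.
Qed.

Lemma idotZl k u h : idot (k *: u) h = k * idot u h.
Proof. by rewrite /idot mulr_sumr; apply: eq_bigr => i _; rewrite mxE mulrCA. Qed.

Lemma idot_delta i h : idot (delta_mx 0 i) h = h 0 i.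
Proof.
rewrite /idot (bigD1 i) //= mxE !eqxx mulr1 big1 ?addr0 // => j ji.
by rewrite mxE (negbTE ji) andbF mulr0.
Qed.

Lemma dotZl (k : int) u l : dot (k *: u) l = k%:~R * dot u l.
Proof.
by rewrite /dot mulr_sumr; apply: eq_bigr => i _; rewrite mxE intrM mulrCA.
Qed.

Lemma dot_delta i l : dot (delta_mx 0 i) l = l 0 i.
Proof.
rewrite /dot (bigD1 i) //= mxE !eqxx mulr1 big1 ?addr0 // => j ji.
by rewrite mxE eqxx (negbTE ji) mulr0.
Qed.

Definition norm1_row u : int := \sum_i `|u 0 i|.

Lemma norm1_row_ge0 u : 0 <= norm1_row u.
Proof. exact: sumr_ge0. Qed.

Lemma dot_norm1_row u l (N : nat) : (forall i, `|l 0 i| <= N%:R) ->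
  `|dot u l| <= N%:R * (norm1_row u)%:~R.
Proof.
move=> lN; apply: le_trans (ler_norm_sum _ _ _) _.
rewrite rmorph_sum mulr_sumr; apply: ler_sum => i _.
by rewrite normrM /= intr_norm ler_wpM2r.
Qed.

Definition floor_row l : 'rV[int]_m := map_mx Num.floor l.
Definition frac_row l : 'rV[rat]_m := l - map_mx intr (floor_row l).

Lemma frac_row_itv l i : 0 <= frac_row l 0 i < 1.
Proof. by have := floor_itv (l 0 i); rewrite !mxE intrD => /andP[]; lra. Qed.

Lemma frac_row_norm l i : `|frac_row l 0 i| <= 1.
Proof. by have /andP[? /ltW] := frac_row_itv l i; rewrite ger0_norm. Qed.

Lemma frac_row_le l i : 0 <= l 0 i -> frac_row l 0 i <= l 0 i.
Proof. by move=> l0; rewrite !mxE gerBl ler0z floor_ge0. Qed.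

Lemma dot_frac_row u l : dot u (frac_row l) = dot u l - (idot u (floor_row l))%:~R.
Proof. by rewrite dotBr dot_int. Qed.

Lemma dot_frac_row_norm u l : `|dot u (frac_row l)| <= (norm1_row u)%:~R.
Proof.
by have := @dot_norm1_row u (frac_row l) 1 (frac_row_norm l); rewrite mul1r.
Qed.

Lemma floor_dot_frac_row u l : `|Num.floor (dot u (frac_row l))| <= norm1_row u.
Proof.
have := dot_frac_row_norm u l; rewrite !ler_norml floor_ge_int rmorphN /=.
move=> /andP[-> le_u]; rewrite -(ler_int rat).
exact: le_trans (floor_le _) le_u.
Qed.

(** [(u, a, k)] encodes the affine form mapping [(l, s)] to u l + a s + k; the
second component lives in [rat^o] so that pairs form a vector space. *)
Definition affine_form (f : 'rV[int]_m * int * rat) (e : 'rV[rat]_m * rat^o) : rat :=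
  dot f.1.1 e.1 + f.1.2%:~R * e.2 + f.2.

Lemma affine_form_segment f e e' t :
  affine_form f (e + t *: (e' - e)) = affine_form f e + t * (affine_form f e' - affine_form f e).
Proof.
have e2 : (e + t *: (e' - e)).2 = e.2 + t * (e'.2 - e.2) by [].
by rewrite /affine_form e2 dotDr dotZr dotBr; ring.
Qed.

Lemma affine_formE u a k e :
  affine_form (u, a, k) e = dot u e.1 + a%:~R * e.2 + k.
Proof. by []. Qed.

End Pairing.

(** The functionals that are constant along the ultrafilter form a space of
finite dimension. Taking W with as many independent rows as possible among
them, it is enough that the rows of W are constant simultaneously. This makes
a single x0 typical for infinitely many functionals at once. *)
Lemma ultra_constant_functionals m (X : Type) (U : set_system X)
    (h : X -> 'rV[int]_m) : UltraFilter U ->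
  \forall x0 \near U, forall u, (exists k, \forall x \near U, idot u (h x) = k) ->
    \forall x \near U, idot u (h x) = idot u (h x0).
Proof.
move=> UU; pose hq x : 'cV[rat]_m := (map_mx intr (h x))^T.
pose constant n (W : 'M[rat]_(n, m)) := exists k, \forall x \near U, W *m hq x = k.
pose P r := `[< exists2 W : 'M[rat]_m, constant m W & \rank W = r >].
have exP : exists r, P r.
  exists 0%N; apply/asboolP; exists 0; rewrite ?mxrank0 //.
  by exists 0; apply: nearW => x; rewrite mul0mx.
have ubP r : P r -> (r <= m)%N by move=> /asboolP[W _ <-]; apply: rank_leq_col.
case: (ex_maxnP exP ubP) => r /asboolP[W [k Wk] rW] rmax.
apply: filterS (Wk) => x0 Wx0 u [z uz]; pose uq : 'rV[rat]_m := map_mx intr u.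
suff /submxP[D uD] : (uq <= W)%MS.
  apply: filterS Wk => x Wx; apply: (@mulrIz rat 1); rewrite ?oner_neq0 //.
  have := idot_mx u (h x); rewrite -/uq uD -mulmxA -/(hq x) Wx -Wx0 mulmxA -uD.
  by rewrite idot_mx => /matrixP/(_ 0 0); rewrite !mxE !eqxx !mulr1n.
have uW : constant m (W + uq)%MS.
  have /submxP[D ->] : (W + uq <= col_mx W uq)%MS by rewrite addsmxE.
  exists (D *m col_mx k (z%:~R%:M)); apply: filterS2 Wk uz => x Wx ux.
  by rewrite -mulmxA mul_col_mx Wx idot_mx ux.
have rle : (\rank (W + uq) <= \rank W)%N.
  by rewrite rW; apply: rmax; apply/asboolP; exists (W + uq)%MS.
have [rge rE] := mxrank_leqif_sup (addsmxSl W uq).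
by apply: submx_trans (addsmxSr W uq) _; rewrite -rE eqn_leq rge rle.
Qed.

(** * Denominators and the monoid generated by numbers of both signs *)

Lemma common_denominator (I : finType) (x : I -> rat) :
  exists2 N : nat, (0 < N)%N & exists z : I -> int, forall i, N%:R * x i = (z i)%:~R.
Proof.
pose N := (\prod_i `|denq (x i)|)%N.
exists N; first by rewrite prodn_gt0 // => i; rewrite absz_gt0 denq_neq0.
suff /choice[z zP] : forall i, exists z : int, N%:R * x i = z%:~R by exists z.
move=> i; exists (numq (x i) * (\prod_(j | j != i) `|denq (x j)|)%N%:Z).
rewrite /N (bigD1 i) //= natrM intrM.
have den0 : (denq (x i))%:~R != 0 :> rat by rewrite intr_eq0 denq_neq0.
rewrite natr_absz normr_denq -pmulrn -[X in _ * X = _]divq_num_den.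
by move: (_%:R) den0 => P; move: (numq _)%:~R (denq _)%:~R => a b b0; field.
Qed.

(** The generator is the least positive element g; with an element b < 0, the
opposite of g is g copies of b plus |b| - 1 copies of g. *)
Lemma int_monoid_cyclic (M : set int) :
    M 0 -> (forall x y, M x -> M y -> M (x + y)) ->
    (exists2 x, M x & 0 < x) -> (exists2 x, M x & x < 0) ->
  exists2 g, 0 < g & forall x, M x <-> (g %| x)%Z.
Proof.
move=> M0 MD [a Ma a0] [b Mb b0].
have MMn x n : M x -> M (x *+ n).
  by move=> Mx; elim: n => [|n IHn] //; rewrite mulrS; apply: MD.
have exM : exists n, `[< (0 < n)%N /\ M n%:Z >].
  by exists `|a|%N; apply/asboolP; rewrite absz_gt0 gt_eqF // gtz0_abs.
case: (ex_minnP exM) => g /asboolP[g0 Mg] gmin.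
have MNg : M (- g%:Z).
  have -> : - g%:Z = b *+ g + g%:Z *+ (absz b).-1.
    have bE : (absz b).-1%:Z = - b - 1 by lia.
    by rewrite -[b *+ g]mulr_natr -[g%:Z *+ _]mulr_natr !natz bE; ring.
  by apply: MD; apply: MMn.
have Mgk k : M (g%:Z * k).
  case: (intP k) => [|n|n]; first by rewrite mulr0.
    by rewrite -[n.+1%:Z]natz mulr_natr; apply: MMn.
  by rewrite mulrN -mulNr -[n.+1%:Z]natz mulr_natr; apply: MMn.
exists g%:Z => // x; split=> [Mx|/dvdzP[k ->]]; last by rewrite mulrC.
apply/dvdz_mod0P/eqP/negPn/negP => xg.
have xg0 : (0 <= x %% g)%Z by rewrite modz_ge0 // eqz_nat gt_eqF.
have xglt : (x %% g < g)%Z by rewrite ltz_pmod.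
suff: (g <= `|(x %% g)%Z|)%N by lia.
apply: gmin; apply/asboolP; split; first by lia.
rewrite gez0_abs //.
have -> : (x %% g)%Z = x + g%:Z * (- (x %/ g)%Z).
  by rewrite {2}(divz_eq x g); ring.
exact: MD.
Qed.

(** After division by the generator of the monoid of their integer combinations,
the given numbers become integers whose natural combinations are all of Z. *)
Lemma mixed_signs_generate p (x : 'I_p -> rat) :
    (exists j, 0 < x j) -> (exists j, x j < 0) ->
  exists2 t, 0 < t & exists2 D : 'I_p -> int, forall j, t * x j = (D j)%:~R &
    forall k : int, exists mu : {ffun 'I_p -> nat}, \sum_j (mu j)%:R * D j = k.
Proof.
move=> [j1 x1] [j2 x2]; have [N N0 [z zP]] := common_denominator x.
have N0' : (0 : rat) < N%:R by rewrite ltr0n.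
pose M := [set k | exists mu : {ffun 'I_p -> nat}, \sum_j (mu j)%:R * z j = k].
have Mz j : M (z j).
  exists [ffun i => (i == j) : nat]; rewrite (bigD1 j) //= ffunE eqxx mul1r.
  by rewrite big1 ?addr0 // => i /negbTE ij; rewrite ffunE ij mul0r.
have [|||| g g0 gP] := @int_monoid_cyclic M.
- by exists [ffun=> 0%N]; rewrite big1 // => i _; rewrite ffunE mul0r.
- move=> _ _ [mu <-] [mu' <-]; exists [ffun i => (mu i + mu' i)%N].
  by rewrite -big_split; apply: eq_bigr => i _; rewrite ffunE natrD mulrDl.
- by exists (z j1) => //; rewrite -(ltr0z rat) -zP mulr_gt0.
- by exists (z j2) => //; rewrite -(ltrz0 rat) -zP pmulr_rlt0.
exists (N%:R / g%:~R); first by rewrite divr_gt0 // ltr0z.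
have g0' : g%:~R != 0 :> rat by rewrite intr_eq0 gt_eqF.
have /choice[D zD] j : exists Dj, z j = Dj * g.
  by have /gP/dvdzP := Mz j.
exists D => [j|k]; first by rewrite mulrAC zP zD intrM mulfK.
have /gP[mu muE] : (g %| k * g)%Z by rewrite dvdz_mull.
exists mu; apply: (@mulIf _ g); rewrite ?gt_eqF // -muE mulr_suml.
by apply: eq_bigr => j _; rewrite zD mulrA.
Qed.

(** * Gap-free inequalities *)

Section Core.
Variables (R : realType) (m q p : nat).
Variables (c : 'I_q -> 'rV[int]_m) (d : 'I_p -> 'rV[int]_m).

Notation E := ('rV[rat]_m * rat^o)%type.
Implicit Types (e f : E) (y : 'rV[R]_m) (b : 'I_q) (mu : {ffun 'I_p -> nat}).
Implicit Types (u : 'rV[int]_m) (l : 'rV[rat]_m).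

(** The row of which [defect b mu] is the functional: the slacks at the point of S
reached from the base point b by adding the j-th generator [mu j] times. *)
Definition defect_row b mu : 'rV[int]_m := c b - \sum_j d j *+ mu j.

Definition defect b mu l : rat := dot (defect_row b mu) l.

Lemma defectE b mu l :
  defect b mu l = dot (c b) l - \sum_j (mu j)%:R * dot (d j) l.
Proof. by rewrite /defect /defect_row dotDl dotNl dot_suml. Qed.

(** No defect falls in [0, s[. Every gap-free pair gives an inequality that the
cut of the same multiplier implies, the strongest choice of s giving the cut
itself. *)
Definition gap_free e : Prop := (forall i, 0 <= e.1 0 i) /\
  forall b mu, (defect b mu e.1 < 0) || (e.2 <= defect b mu e.1).

Definition slack y e : R := \sum_i ratr (e.1 0 i) * y 0 i - ratr e.2.

Definition gap_region : set 'rV[R]_m := [set y | forall e, gap_free e -> 0 <= slack y e].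

(** Valid inequalities are the closed convex counterpart of the gap-free ones: a
limit of gap-free pairs is valid, but need not be gap-free. *)
Definition valid e := forall y, gap_region y -> 0 <= slack y e.

Definition implied (F : seq E) e :=
  forall y, {in F, forall f, 0 <= slack y f} -> 0 <= slack y e.

Lemma slack_segment y e e' t :
  slack y (e + t *: (e' - e)) = slack y e + ratr t * (slack y e' - slack y e).
Proof.
have e2 : (e + t *: (e' - e)).2 = e.2 + t * (e'.2 - e.2) by [].
rewrite /slack e2 rmorphD rmorphM rmorphB /=.
transitivity (\sum_i (ratr (e.1 0 i) * y 0 i + ratr t *
    (ratr (e'.1 0 i) * y 0 i - ratr (e.1 0 i) * y 0 i)) -
    (ratr e.2 + ratr t * (ratr e'.2 - ratr e.2))).
  congr (_ - _); apply: eq_bigr => i _.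
  by rewrite !mxE rmorphD rmorphM rmorphB /=; ring.
by rewrite big_split /= -mulr_sumr sumrB; ring.
Qed.

Lemma slackZ y t e : slack y (t *: e) = ratr t * slack y e.
Proof.
have e2 : (t *: e).2 = t * e.2 by [].
rewrite /slack e2 rmorphM /= mulrBr mulr_sumr.
by congr (_ - _); apply: eq_bigr => i _; rewrite mxE rmorphM /=; ring.
Qed.

Lemma slack_limit y e e' :
  (forall t, 0 < t <= 1 -> 0 <= slack y (e + t *: (e' - e))) -> 0 <= slack y e.
Proof.
move=> segP; rewrite leNgt; apply/negP => lt0.
set D := slack y e' - slack y e.
have := archi_boundP (normr_ge0 (D / slack y e)).
set k := Num.Def.archi_bound _ => Dk.
have := segP (k.+1%:R)^-1; rewrite invr_gt0 ltr0n invf_le1 ?ltr0n // ler1n /=.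
move=> /(_ isT); rewrite slack_segment -/D fmorphV rmorph_nat.
rewrite -(pmulr_rge0 _ (ltr0Sn R k)) mulrDr mulrA divff ?pnatr_eq0 // mul1r.
suff: D < - (k.+1%:R * slack y e) by lra.
rewrite -mulrN -ltr_pdivrMr ?oppr_gt0 //.
have := ler_norm (- (D / slack y e)); rewrite normrN invrN mulrN => le1.
by apply: le_lt_trans le1 (lt_trans Dk _); rewrite ltr_nat.
Qed.

Lemma gap_freeZ t e : 0 < t -> gap_free e -> gap_free (t *: e).
Proof.
move=> t0 [e0 eP]; split=> [i|b mu]; first by rewrite mxE mulr_ge0 // ltW.
have -> : (t *: e).2 = t * e.2 by [].
rewrite /defect /= dotZr pmulr_rlt0 // ler_pM2l //.
exact: eP.
Qed.

Lemma gap_region_bound y l s : gap_region y -> gap_free (l, s) ->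
  ratr s <= \sum_i ratr (l 0 i) * y 0 i.
Proof. by move=> yR /yR; rewrite subr_ge0. Qed.

(** Otherwise [(l, s)] would be gap-free for every s, and no y could satisfy all
these inequalities. *)
Lemma defect_ge0_exists l : gap_region !=set0 -> (forall i, 0 <= l 0 i) ->
  exists b mu, 0 <= defect b mu l.
Proof.
move=> [y yR] l0; apply: contrapT => noz.
pose s := \sum_i ratr (l 0 i) * y 0 i.
suff /(gap_region_bound yR) : gap_free (l, (Num.Def.archi_bound `|s|)%:R).
  by rewrite ratr_nat leNgt (le_lt_trans (ler_norm _)) // archi_boundP ?normr_ge0.
split=> // b mu; apply/orP; left; rewrite ltNge; apply/negP => ?.
by apply: noz; exists b, mu.
Qed.

Lemma defect_shift b mu j (n : nat) l :
  defect b [ffun i => (mu i + (i == j) * n)%N] l = defect b mu l - n%:R * dot (d j) l.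
Proof.
rewrite !defectE -addrA -opprD; congr (_ - _).
rewrite (bigD1 j) //= [in RHS](bigD1 j) //= !ffunE eqxx mul1n natrD.
rewrite mulrDl -!addrA; congr (_ + _); rewrite addrC; congr (_ + _).
by apply: eq_bigr => i /negbTE ij; rewrite ffunE ij mul0n addn0.
Qed.

Section Local.
Variables (X : Type) (U : set_system X).
Context {UU : UltraFilter U}.

(** The form in which compactness is used: the ultrafilter U follows a family e
of pairs, and one finite set of valid inequalities must take care of almost
all of it. *)
Definition tame (e : X -> E) :=
  exists2 F : seq E, {in F, forall f, valid f} & \forall x \near U, implied F (e x).

Definition unit_ineqs : seq E := [seq (delta_mx 0 i, 0) | i : 'I_m].

Lemma unit_ineqs_valid : {in unit_ineqs, forall f, valid f}.
Proof.
move=> _ /mapP[i _ ->] y; apply; split=> [j|b mu] /=; first by rewrite mxE ler0n.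
by rewrite leNgt orbN.
Qed.

Lemma slack_unit_ineqs y : {in unit_ineqs, forall f, 0 <= slack y f} ->
  forall i, 0 <= y 0 i.
Proof.
move=> Fy i; have := Fy (delta_mx 0 i, 0) (map_f _ (mem_enum _ i)).
rewrite /slack /= rmorph0 subr0 (bigD1 i) //= mxE !eqxx rmorph1 mul1r.
rewrite big1 ?addr0 // => j ji; by rewrite mxE (negbTE ji) andbF rmorph0 mul0r.
Qed.

Lemma tame_nonpos (e : X -> E) :
    (\forall x \near U, (forall i, 0 <= (e x).1 0 i) /\ (e x).2 <= 0) ->
  tame e.
Proof.
move=> eP; exists unit_ineqs; first exact: unit_ineqs_valid.
apply: filterS eP => x [ex0 ex2] y /slack_unit_ineqs y0.
rewrite subr_ge0 (@le_trans _ _ 0) ?lerq0 // sumr_ge0 // => i _.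
by rewrite mulr_ge0 ?ler0q.
Qed.

Lemma tame_scale (t : X -> rat) (e : X -> E) :
    (\forall x \near U, 0 < t x) -> tame (fun x => t x *: e x) ->
  tame e.
Proof.
move=> t0 [F Fvalid Fe]; exists F => //.
apply: filterS2 t0 Fe => x tx0 Fx y /Fx.
by rewrite slackZ pmulr_rge0 // ltr0q.
Qed.

(** Decreasing the multiplier strengthens the inequality, because y >= 0 is itself
one of the valid inequalities. *)
Lemma tame_dominated (l : X -> 'rV[rat]_m) (e : X -> E) :
    (\forall x \near U, forall i, l x 0 i <= (e x).1 0 i) ->
  tame (fun x => (l x, (e x).2) : E) -> tame e.
Proof.
move=> le_l [F Fvalid Fl]; exists (unit_ineqs ++ F).
  by move=> f; rewrite mem_cat => /orP[/unit_ineqs_valid|/Fvalid].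
apply: filterS2 le_l Fl => x lex Fx y Fy.
have /slack_unit_ineqs y0 : {in unit_ineqs, forall f, 0 <= slack y f}.
  by move=> f fU; apply: Fy; rewrite mem_cat fU.
have /Fx : {in F, forall f, 0 <= slack y f}.
  by move=> f fF; apply: Fy; rewrite mem_cat fF orbT.
move=> /le_trans; apply; rewrite /slack /= lerD2r; apply: ler_sum => i _.
by rewrite ler_wpM2r // ler_rat.
Qed.

Definition in_box (N : rat) e := (forall i, `|e.1 0 i| <= N) /\ `|e.2| <= N.

(** Here Q is what is known of typical pairs, and the signs of the forms [cand]
together with Q are assumed to decide gap-freeness inside the box. The pairs
with the signs of a typical one form a half-open polytope. A vertex v of its
closure is valid: the half-open segment from v to a typical pair has the
typical signs, hence consists of gap-free pairs, and validity passes to the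
limit. *)
Lemma tame_bounded (N : rat) (I : finType) (cand : I -> 'rV[int]_m * int * rat)
    (Q : E -> Prop) (e : X -> E) :
    (\forall x \near U, in_box N (e x) /\ Q (e x)) ->
    (forall f f', in_box N f -> in_box N f' -> Q f ->
      (forall k, sgz (affine_form (cand k) f) = sgz (affine_form (cand k) f')) ->
      gap_free f') ->
  tame e.
Proof.
move=> eP Qgood.
have Usgn k : \forall x0 \near U, \forall x \near U,
    sgz (affine_form (cand k) (e x0)) = sgz (affine_form (cand k) (e x)).
  have [|s sU] := @ultra_int_bounded _ U _
      (fun x => sgz (affine_form (cand k) (e x))) 1.
    by apply: nearW => x; case: sgzP.
  by apply: filterS (sU) => x0 ->; apply: filterS sU => x ->.
have {Usgn} : \forall x0 \near U, forall k, \forall x \near U,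
    sgz (affine_form (cand k) (e x0)) = sgz (affine_form (cand k) (e x)).
  by apply: filter_forall.
move=> /(filterI eP) /filter_ex[x0 [[box0 Q0] sgn0]].
have {}sgn0 : \forall x \near U, forall k,
    sgz (affine_form (cand k) (e x0)) = sgz (affine_form (cand k) (e x)).
  exact: filter_forall.
pose coord (i : option 'I_m) : 'rV[int]_m * int * rat :=
  if i is Some i then (delta_mx 0 i, 0, 0) else (0, 1, 0).
pose coordE f (i : option 'I_m) : rat := if i is Some i then f.1 0 i else f.2.
have coordP i f : affine_form (coord i) f = coordE f i.
  case: i => [i|]; rewrite /affine_form /= ?dot_delta ?dot0l ?mul0r ?mul1r ?addr0 //.
  by rewrite add0r.
pose sg (k : I) : rat := (sgz (affine_form (cand k) (e x0)))%:~R.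
(* The closed polytope cut out by the box and by the weak sign conditions that
   hold at e x0; a form that vanishes there contributes two inequalities. *)
pose phi (i : (option 'I_m * bool) + (I * bool)) f : rat :=
  match i with
  | inl (i, true) => N - coordE f i
  | inl (i, false) => N + coordE f i
  | inr (k, true) => if 0 <= sg k then affine_form (cand k) f else 0
  | inr (k, false) => if sg k <= 0 then - affine_form (cand k) f else 0
  end.
have phi_box f : (forall i, 0 <= phi i f) -> in_box N f.
  move=> f0; have fN i : `|coordE f i| <= N.
    have := f0 (inl (i, true)); have := f0 (inl (i, false)) => /= ? ?.
    by rewrite ler_norml; apply/andP; split; lra.
  by split=> [i|]; [apply: (fN (Some i))|apply: (fN None)].
have box_phi f i : in_box N f -> 0 <= phi (inl i) f.
  move=> [f1 f2]; have : `|coordE f i.1| <= N.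
    by case: i => [[i|] ?]; [apply: f1|apply: f2].
  by rewrite ler_norml; case: i => [i []] /= /andP[]; lra.
have [||vs vsK vsC] := @polytope_hull rat E _ phi.
- move=> [[i []]|[k []]] f f' t /=.
  + by rewrite -!coordP affine_form_segment; ring.
  + by rewrite -!coordP affine_form_segment; ring.
  + by case: ifP => _; rewrite ?affine_form_segment //; ring.
  + by case: ifP => _; rewrite ?affine_form_segment //; ring.
- move=> f f' neq; have [i ff'i] : exists i, coordE f i != coordE f' i.
    apply: contrapT => /forallNP eqff'; case/negP: neq; apply/eqP.
    have {}eqff' i : coordE f i = coordE f' i.
      by have /negP := eqff' i; rewrite negbK => /eqP.
    case: f f' eqff' => [f1 f2] [f1' f2'] eqff'; congr (_, _).
      by apply/rowP => i; apply: (eqff' (Some i)).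
    exact: (eqff' None).
  have [lt|gt|eq] := ltgtP (coordE f i) (coordE f' i).
  + by exists (inl (i, true)); rewrite /= ltrD2l ltrN2.
  + by exists (inl (i, false)); rewrite /= ltrD2l.
  + by rewrite eq eqxx in ff'i.
exists vs.
  move=> v /vsK Kv y yR; apply: (@slack_limit _ _ (e x0)) => t /andP[t0 t1].
  apply: yR; apply: (Qgood (e x0)) => // [|k].
    have [v1 v2] := phi_box _ Kv; have [e1 e2] := box0.
    have mix (a a' : rat) : `|a| <= N -> `|a'| <= N -> `|a + t * (a' - a)| <= N.
      by rewrite !ler_norml => /andP[? ?] /andP[? ?]; apply/andP; split; nra.
    by split=> [i|]; [have := mix _ _ (v1 i) (e1 i); rewrite !mxE|apply: mix].
  have := Kv (inr (k, true)); have := Kv (inr (k, false)); rewrite /= /sg.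
  rewrite ler0z lerz0 sgz_ge0 sgz_le0 affine_form_segment.
  move: (affine_form _ v) (affine_form _ (e x0)) => a a'.
  case: (ltgtP a' 0) => [a'0 a0 _|a'0 _ a0|-> a_le0 a_ge0].
  - by rewrite !ltr0_sgz //; nra.
  - by rewrite !gtr0_sgz //; nra.
  - have -> : a = 0 by lra.
    by rewrite subrr mulr0 addr0.
apply: filterS2 eP sgn0 => x [boxx _] sgnx y vsy.
apply: (vsC (fun f => 0 <= slack y f)) => //.
  move=> f f' t /andP[t0 t1] f0 f'0; rewrite slack_segment.
  rewrite -(ler_rat R) rmorph0 in t0; rewrite -(ler_rat R) rmorph1 in t1.
  by move: (ratr t) (slack y f) (slack y f') t0 t1 f0 f'0 => t' a a'; nra.
move=> [i|[k []]]; first exact: box_phi.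
  by rewrite /= /sg ler0z sgnx sgz_ge0; case: ifP.
by rewrite /= /sg lerz0 sgnx sgz_le0; case: ifP => //; rewrite oppr_ge0.
Qed.

(** A base point with negative defect is harmless when no generator changes the
defect; the others only move up from a defect that is at least s. So the
signs of [c b] and of [c b - s] decide gap-freeness. *)
Lemma tame_bounded_below (e : X -> E) : gap_region !=set0 ->
    (\forall x \near U, [/\ gap_free (e x), 0 < (e x).2,
      forall j, dot (d j) (e x).1 <= 0 &
      (forall j, dot (d j) (e x).1 = 0) \/ forall b, 0 <= dot (c b) (e x).1]) ->
  tame e.
Proof.
move=> rne eP; have [y yR] := rne.
pose t (l : 'rV[rat]_m) := (\sum_i l 0 i)^-1.
have t_gt0 : \forall x \near U, 0 < t (e x).1.
  apply: filterS eP => x [ge e20 _ _].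
  rewrite invr_gt0 lt_neqAle sumr_ge0 ?andbT; last by move=> i _; case: ge.
  apply/eqP => /esym/eqP; rewrite psumr_eq0; last by move=> i _; case: ge.
  move=> /allP l0.
  have := gap_region_bound yR ge; rewrite big1 ?ler0q ?lerq0 ?leNgt ?e20 // => i _.
  by have /eqP-> := l0 i (mem_index_enum _); rewrite rmorph0 mul0r.
apply: (@tame_scale (fun x => t (e x).1)) => //.
pose N := (Num.Def.archi_bound (\sum_i `|y 0 i|)).+1.
pose cand k : 'rV[int]_m * int * rat :=
  match k with
  | inl (inl i) => (delta_mx 0 i, 0, 0)
  | inl (inr j) => (d j, 0, 0)
  | inr (inl b) => (c b, 0, 0)
  | inr (inr b) => (c b, -1, 0)
  end.
pose Q f := [/\ gap_free f, forall j, dot (d j) f.1 <= 0 &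
  (forall j, dot (d j) f.1 = 0) \/ forall b, 0 <= dot (c b) f.1].
apply: (@tame_bounded N%:R _ cand Q).
  apply: filterS2 t_gt0 eP => x t0 [ge e20 dle cd].
  have gte := gap_freeZ t0 ge.
  have sum1 : \sum_i (t (e x).1 *: (e x)).1 0 i = 1.
    under eq_bigr do rewrite mxE; rewrite -mulr_sumr mulVf //.
    by rewrite gt_eqF // -invr_gt0.
  have le1 i : (t (e x).1 *: (e x)).1 0 i <= 1.
    rewrite -sum1 (bigD1 i) //= lerDl sumr_ge0 // => j _.
    by case: gte.
  split; first split=> [i|].
  - have [/(_ i) ge0 _] := gte; rewrite ger0_norm // (le_trans (le1 i)) //.
    by rewrite ler1n.
  - rewrite ger0_norm; last by rewrite ltW // pmulr_rgt0.
    rewrite -(ler_rat R) (le_trans (gap_region_bound yR gte)) // ratr_nat.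
    apply: (@le_trans _ _ (\sum_i `|y 0 i|)).
      apply: ler_sum => i _; apply: le_trans (ler_norm _) _.
      rewrite normrM ler_piMl // ger0_norm ?ler0q; last by case: gte.
      by rewrite -(rmorph1 (ratr : rat -> R)) ler_rat.
    rewrite (@le_trans _ _ (Num.Def.archi_bound (\sum_i `|y 0 i|))%:R) ?ler_nat //.
    by rewrite ltW // archi_boundP // sumr_ge0.
  - split=> // [j|]; first by rewrite dotZr pmulr_rle0.
    case: cd => [d0|c0]; [left=> j|right=> b].
      by rewrite dotZr d0 mulr0.
    by rewrite dotZr mulr_ge0 // ltW.
move=> f f' _ _ [[f0 fP] dle cd] sgnE.
have sgn_l i : sgz (f.1 0 i) = sgz (f'.1 0 i).
  by have := sgnE (inl (inl i)); rewrite !affine_formE !dot_delta !mul0r !addr0.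
have sgn_d j : sgz (dot (d j) f.1) = sgz (dot (d j) f'.1).
  by have := sgnE (inl (inr j)); rewrite !affine_formE !mul0r !addr0.
have sgn_c b : sgz (dot (c b) f.1) = sgz (dot (c b) f'.1).
  by have := sgnE (inr (inl b)); rewrite !affine_formE !mul0r !addr0.
have sgn_cs b : sgz (dot (c b) f.1 - f.2) = sgz (dot (c b) f'.1 - f'.2).
  by have := sgnE (inr (inr b)); rewrite !affine_formE !mulN1r !addr0.
split=> [i|b mu]; first by rewrite -sgz_ge0 -sgn_l sgz_ge0.
have d'le j : dot (d j) f'.1 <= 0 by rewrite -sgz_le0 -sgn_d sgz_le0.
rewrite defectE; have [c_lt0|c_ge0] := ltP (dot (c b) f.1) 0.
  apply/orP; left; case: cd => [d0|/(_ b)]; last by rewrite leNgt c_lt0.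
  rewrite big1 ?subr0 => [|j _]; first by rewrite -sgz_lt0 -sgn_c sgz_lt0.
  suff -> : dot (d j) f'.1 = 0 by rewrite mulr0.
  by apply/eqP; rewrite -sgz_eq0 -sgn_d sgz_eq0 d0.
apply/orP; right; apply: (@le_trans _ _ (dot (c b) f'.1)).
  rewrite -subr_ge0 -sgz_ge0 -sgn_cs sgz_ge0 subr_ge0.
  have := fP b [ffun=> 0%N]; rewrite defectE big1 ?subr0 => [|j _].
    by rewrite ltNge c_ge0.
  by rewrite ffunE mul0r.
rewrite lerDl oppr_ge0 sumr_le0 // => j _; by rewrite mulr_ge0_le0.
Qed.

(** The defects of [l x] from a given base point b form a full class modulo 1.
Hence [s x] is at most the fractional part of [dot (c b) (l x)], a condition
that survives when the integer part of [l x] is removed. The fractional parts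
being bounded, the integers w (values of the generators) and k (floors at the
base points) are constant along U and describe the situation by finitely many
affine forms. *)
Lemma tame_mixed (e : X -> E) j1 j2 : gap_region !=set0 ->
    (\forall x \near U, [/\ gap_free (e x), 0 < (e x).2,
      0 < dot (d j1) (e x).1 & dot (d j2) (e x).1 < 0]) ->
  tame e.
Proof.
move=> rne eP.
pose tP (l : 'rV[rat]_m) (t : rat) := 0 < t /\
  exists2 D : 'I_p -> int, forall j, t * dot (d j) l = (D j)%:~R &
    forall k : int, exists mu : {ffun 'I_p -> nat}, \sum_j (mu j)%:R * D j = k.
pose t (l : 'rV[rat]_m) : rat := xget 1 (tP l).
have tPx : \forall x \near U, tP (e x).1 (t (e x).1).
  apply: filterS eP => x [_ _ d1 d2]; rewrite /t; apply: xgetPex.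
  have [||s s0 [D sD DP]] := @mixed_signs_generate p (fun j => dot (d j) (e x).1).
  - by exists j1.
  - by exists j2.
  - by exists s; split=> //; exists D.
apply: (@tame_scale (fun x => t (e x).1)) => //.
  by apply: filterS tPx => x [].
pose l x : 'rV[rat]_m := t (e x).1 *: (e x).1.
pose s x : rat := t (e x).1 * (e x).2.
have {tPx eP} lsP : \forall x \near U, [/\ gap_free (l x, s x), 0 < s x &
    exists2 D : 'I_p -> int, forall j, dot (d j) (l x) = (D j)%:~R &
    forall k : int, exists mu : {ffun 'I_p -> nat}, \sum_j (mu j)%:R * D j = k].
  apply: filterS2 tPx eP => x [t0 [D tD DP]] [ge e20 _ _].
  split; [exact: gap_freeZ|exact: mulr_gt0|exists D => // j].
  by rewrite dotZr.
apply: (@tame_dominated (fun x => frac_row (l x))).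
  apply: filterS lsP => x [[l0 _] _ _] i.
  by apply: frac_row_le; apply: l0.
have /choice[w wP] j : exists w, \forall x \near U, dot (d j) (frac_row (l x)) = w%:~R.
  have [|w wU] := @ultra_int_bounded _ U _
      (fun x => Num.floor (dot (d j) (frac_row (l x)))) (norm1_row (d j)).
    by apply: nearW => x; apply: floor_dot_frac_row.
  exists w; apply: filterS2 lsP wU => x [_ _ [D lD _]] <-.
  by rewrite dot_frac_row lD -rmorphB /= intrKfloor.
have /choice[k kP] b : exists k, \forall x \near U,
    Num.floor (dot (c b) (frac_row (l x))) = k.
  apply: (@ultra_int_bounded _ U _ _ (norm1_row (c b))).
  by apply: nearW => x; apply: floor_dot_frac_row.
have /filter_forall {}wP := wP; have /filter_forall {}kP := kP.
have gapP : \forall x \near U, forall b, s x <= dot (c b) (frac_row (l x)) - (k b)%:~R.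
  apply: filterS2 lsP kP => x [[_ gap] s0 [D lD DP]] kx b.
  have [mu muE] := DP (k b + idot (c b) (floor_row (l x))).
  have := gap b mu; rewrite /= defectE.
  have -> : \sum_j (mu j)%:R * dot (d j) (l x) =
      (k b)%:~R + (idot (c b) (floor_row (l x)))%:~R.
    rewrite -rmorphD -muE rmorph_sum /=; apply: eq_bigr => j _.
    by rewrite lD rmorphM /= rmorph_nat.
  rewrite dot_frac_row -kx dot_frac_row; set a := dot _ _; set z := (idot _ _)%:~R.
  have /andP[fl _] := floor_itv (a - z).
  by move: fl; move: (Num.floor _)%:~R (s x : rat) => fl sx ? /orP[]; lra.
pose cand k' : 'rV[int]_m * int * rat :=
  match k' with
  | inl (inl i) => (delta_mx 0 i, 0, 0)
  | inl (inr j) => (d j, 0, - (w j)%:~R)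
  | inr (inl b) => (c b, -1, - (k b)%:~R)
  | inr (inr b) => (c b, 0, - (k b)%:~R - 1)
  end.
pose Q f := [/\ forall i, 0 <= f.1 0 i, forall j, dot (d j) f.1 = (w j)%:~R,
  forall b, f.2 <= dot (c b) f.1 - (k b)%:~R &
  forall b, dot (c b) f.1 - (k b)%:~R < 1].
apply: (@tame_bounded 1 _ cand Q).
  have wkP : \forall x \near U, (forall j, dot (d j) (frac_row (l x)) = (w j)%:~R) /\
      forall b, Num.floor (dot (c b) (frac_row (l x))) = k b by apply: filterS2 wP kP.
  apply: filterS3 lsP gapP wkP => x [gx s0 _] gapx [wx kx].
  have klt b : dot (c b) (frac_row (l x)) - (k b)%:~R < 1.
    rewrite -kx ltrBlDl; have /andP[_] := floor_itv (dot (c b) (frac_row (l x))).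
    by rewrite rmorphD.
  split; first split=> [i|].
  - by have /andP[? /ltW] := frac_row_itv (l x) i; rewrite ger0_norm.
  - have [b _] := defect_ge0_exists rne gx.1.
    by rewrite ger0_norm ?(ltW s0) // (le_trans (gapx b)) // ltW.
  - by split=> [i|j|b|b]; [case/andP: (frac_row_itv (l x) i)|exact: wx|exact: gapx|exact: klt].
move=> f f' _ _ [f0 fd fk fk1] sgnE.
have sgn_l i : sgz (f.1 0 i) = sgz (f'.1 0 i).
  by have := sgnE (inl (inl i)); rewrite !affine_formE !dot_delta !mul0r !addr0.
have sgn_d j : sgz (dot (d j) f.1 - (w j)%:~R) = sgz (dot (d j) f'.1 - (w j)%:~R).
  by have := sgnE (inl (inr j)); rewrite !affine_formE !mul0r !addr0.
have sgn_c b : sgz (dot (c b) f.1 - f.2 - (k b)%:~R) =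
    sgz (dot (c b) f'.1 - f'.2 - (k b)%:~R).
  by have := sgnE (inr (inl b)); rewrite !affine_formE !mulN1r.
have sgn_c1 b : sgz (dot (c b) f.1 + (- (k b)%:~R - 1)) =
    sgz (dot (c b) f'.1 + (- (k b)%:~R - 1)).
  by have := sgnE (inr (inr b)); rewrite !affine_formE !mul0r !addr0.
have f'd j : dot (d j) f'.1 = (w j)%:~R.
  by apply/eqP; rewrite -subr_eq0 -sgz_eq0 -sgn_d sgz_eq0 fd subrr.
have f'k b : f'.2 <= dot (c b) f'.1 - (k b)%:~R.
  have : 0 <= dot (c b) f'.1 - f'.2 - (k b)%:~R.
    by rewrite -sgz_ge0 -sgn_c sgz_ge0; have := fk b; lra.
  by lra.
have f'k1 b : dot (c b) f'.1 - (k b)%:~R < 1.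
  have : dot (c b) f'.1 + (- (k b)%:~R - 1) < 0.
    by rewrite -sgz_lt0 -sgn_c1 sgz_lt0; have := fk1 b; lra.
  by lra.
split=> [i|b mu]; first by rewrite -sgz_ge0 -sgn_l sgz_ge0.
rewrite defectE.
have -> : \sum_j (mu j)%:R * dot (d j) f'.1 = (\sum_j (mu j)%:R * w j)%:~R.
  by rewrite rmorph_sum; apply: eq_bigr => j _; rewrite f'd rmorphM /= rmorph_nat.
move: (\sum_j _) => v; have := f'k b; have := f'k1 b.
have [v_le|v_gt] := lerP v (k b).
  have : v%:~R <= (k b)%:~R :> rat by rewrite ler_int.
  by move=> *; apply/orP; right; lra.
have : (k b)%:~R + 1 <= v%:~R :> rat by rewrite -[1]/(1%:~R) -intrD ler_int lezD1.
by move=> *; apply/orP; left; lra.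
Qed.

(** In this section eps is the common sign of the nonzero values of the [d j], J
the set of the indices where they are nonzero, and the least of their absolute
values, reached at j1, is normalised to 1. Multiplying defects by eps makes
them decrease along every generator. *)

Section OneSign.
Variables (eps : int) (J : {set 'I_p}) (j1 : 'I_p).
Hypotheses (epsP : eps = 1 \/ eps = -1) (j1J : j1 \in J).

Definition directed l := (forall j, j \in J -> 1 <= eps%:~R * dot (d j) l) /\
  (forall j, j \notin J -> dot (d j) l = 0).

(** Only the generators of J change the defect; the multiplicities elsewhere are
dropped since no bound on them could be derived from the defect. *)
Definition trunc_mult mu : {ffun 'I_p -> nat} := [ffun j => if j \in J then mu j else 0%N].

Lemma defect_trunc l b mu : directed l -> defect b (trunc_mult mu) l = defect b mu l.
Proof.
move=> [_ d0]; rewrite !defectE; congr (_ - _); apply: eq_bigr => j _.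
by rewrite ffunE; case: ifP => // /negbT/d0->; rewrite !mulr0.
Qed.

Lemma sdefect_decr l b mu mu' : directed l -> (forall j, (mu j <= mu' j)%N) ->
  eps%:~R * defect b mu' l <= eps%:~R * defect b mu l.
Proof.
move=> [d1 d0] lemu; rewrite !defectE !mulrBr lerD2l lerN2 !mulr_sumr.
apply: ler_sum => j _; rewrite !(mulrCA eps%:~R).
have [jJ|jJ] := boolP (j \in J); last by rewrite d0 // !mulr0.
by rewrite ler_wpM2r ?ler_nat // (le_trans _ (d1 j jJ)).
Qed.

(** One unit beyond zero in the direction of the generators is outside [0, s[:
below it when eps = 1, and above it when eps = -1 because s <= 1. *)
Lemma sdefect_avoids l b mu (s : rat) : s <= 1 -> eps%:~R * defect b mu l <= -1 ->
  (defect b mu l < 0) || (s <= defect b mu l).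
Proof.
move=> s1; case: epsP => ->; rewrite ?intrN ?mulN1r ?mul1r => gapP.
  by apply/orP; left; lra.
by apply/orP; right; lra.
Qed.

(** A multiplicity beyond which every defect over the box of size N has passed
through the interval of length 1 that matters. *)
Definition reach (N : nat) : nat := (N * absz (\sum_b norm1_row (c b))%R).+1.

Lemma sdefect_far (N : nat) l b mu j : (forall i, `|l 0 i| <= N%:R) -> directed l ->
  j \in J -> (reach N <= mu j)%N -> eps%:~R * defect b mu l <= -1.
Proof.
move=> lN dl jJ muj; have [d1 d0] := dl.
pose mu0 : {ffun 'I_p -> nat} := [ffun i => if i == j then mu j else 0%N].
apply: (@le_trans _ _ (eps%:~R * defect b mu0 l)).
  by apply: sdefect_decr => // i; rewrite ffunE; case: eqP => [->|].
rewrite defectE (bigD1 j) //= ffunE eqxx big1 ?addr0 => [|i /negbTE ij]; last first.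
  by rewrite ffunE ij mul0r.
rewrite mulrBr mulrCA.
have wle : norm1_row (c b) <= \sum_b norm1_row (c b).
  by rewrite (bigD1 b) //= lerDl sumr_ge0 // => ? _; apply: norm1_row_ge0.
have ec : eps%:~R * dot (c b) l <= N%:R * (\sum_b norm1_row (c b))%:~R.
  apply: le_trans (ler_norm _) _; rewrite normrM.
  have -> : `|eps%:~R| = 1 :> rat by case: epsP => ->; rewrite ?normrN1 ?normr1.
  rewrite mul1r; apply: le_trans (dot_norm1_row _ lN) _.
  by rewrite ler_wpM2l // ler_int.
have sw : 0 <= \sum_b norm1_row (c b) by apply: sumr_ge0 => *; apply: norm1_row_ge0.
have muR : (reach N)%:R <= (mu j)%:R :> rat by rewrite ler_nat.
have rE : (reach N)%:R = N%:R * (\sum_b norm1_row (c b))%:~R + 1 :> rat.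
  by rewrite -natr1 natrM natr_absz ger0_norm.
have := ler_wpM2l (ler0n rat (mu j)) (d1 j jJ).
by rewrite mulr1 rE in muR *; lra.
Qed.

(** Over a box, generators used [reach N] times or more never hit [0, s[, so that
finitely many points of S decide gap-freeness. *)
Lemma tame_directed_bounded (N : nat) (e : X -> E) :
    (\forall x \near U, [/\ in_box N%:R (e x), gap_free (e x), directed (e x).1 &
      (e x).2 <= 1]) ->
  tame e.
Proof.
move=> eP; pose K := reach N.
pose mu_of (k : {ffun 'I_p -> 'I_K}) : {ffun 'I_p -> nat} := [ffun j => k j : nat].
pose cand i : 'rV[int]_m * int * rat :=
  match i with
  | inl (inl i) => (delta_mx 0 i, 0, 0)
  | inl (inr (inl j)) => (eps *: d j, 0, -1)
  | inl (inr (inr j)) => (d j, 0, 0)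
  | inr (inl tt) => (0, 1, -1)
  | inr (inr (inl (b, k))) => (defect_row b (mu_of k), 0, 0)
  | inr (inr (inr (b, k))) => (defect_row b (mu_of k), -1, 0)
  end.
pose Q f := [/\ gap_free f, directed f.1 & f.2 <= 1].
apply: (@tame_bounded N%:R _ cand Q).
  by apply: filterS eP => x [? ? ? ?]; split.
move=> f f' _ [f'N _] [[f0 fP] [d1 d0] f1] sgnE.
have sgn_l i : sgz (f.1 0 i) = sgz (f'.1 0 i).
  by have := sgnE (inl (inl i)); rewrite !affine_formE !dot_delta !mul0r !addr0.
have sgn_ed j : sgz (eps%:~R * dot (d j) f.1 - 1) = sgz (eps%:~R * dot (d j) f'.1 - 1).
  by have := sgnE (inl (inr (inl j))); rewrite !affine_formE !mul0r !addr0 !dotZl.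
have sgn_d j : sgz (dot (d j) f.1) = sgz (dot (d j) f'.1).
  by have := sgnE (inl (inr (inr j))); rewrite !affine_formE !mul0r !addr0.
have sgn_s : sgz (f.2 - 1) = sgz (f'.2 - 1).
  by have := sgnE (inr (inl tt)); rewrite !affine_formE !dot0l !mul1r !add0r.
have sgn_g b k : sgz (defect b (mu_of k) f.1) = sgz (defect b (mu_of k) f'.1).
  by have := sgnE (inr (inr (inl (b, k)))); rewrite !affine_formE !mul0r !addr0.
have sgn_gs b k : sgz (defect b (mu_of k) f.1 - f.2) = sgz (defect b (mu_of k) f'.1 - f'.2).
  by have := sgnE (inr (inr (inr (b, k)))); rewrite !affine_formE !mulN1r !addr0.
have f'1 : f'.2 <= 1 by rewrite -subr_le0 -sgz_le0 -sgn_s sgz_le0 subr_le0.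
have df' : directed f'.1.
  split=> j jJ; last by apply/eqP; rewrite -sgz_eq0 -sgn_d sgz_eq0 d0.
  by rewrite -subr_ge0 -sgz_ge0 -sgn_ed sgz_ge0 subr_ge0 d1.
split=> [i|b mu]; first by rewrite -sgz_ge0 -sgn_l sgz_ge0.
rewrite -defect_trunc //.
have [/existsP[j /andP[jJ muj]]|] := boolP [exists j in J, (K <= mu j)%N].
  by apply: sdefect_avoids => //; apply: (sdefect_far b f'N df' jJ); rewrite ffunE jJ.
rewrite negb_exists => /forallP lt_mu.
have tr_lt j : (trunc_mult mu j < K)%N.
  rewrite ffunE; have := lt_mu j; rewrite negb_and -ltnNge.
  by case: ifP => //= _; rewrite /K.
pose k : {ffun 'I_p -> 'I_K} := [ffun j => Ordinal (tr_lt j)].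
have -> : trunc_mult mu = mu_of k by apply/ffunP => j; rewrite [RHS]ffunE [k j]ffunE.
have := fP b (mu_of k); rewrite -sgz_lt0 sgn_g sgz_lt0.
by rewrite -[f.2 <= _]subr_ge0 -sgz_ge0 sgn_gs sgz_ge0 subr_ge0.
Qed.

(** The multiplier is split into its fractional part [fr x] and its integer part
[h x], and h is frozen at a typical value [h x0]. The multiplier [l x] obtained
is bounded and below the original one; the point is that it is still gap-free.

A point of S whose signed defect at [l x] lies in the forbidden range has at
[(e x).1] a defect larger, up to the sign eps, by the integer n by which its
defect at h grew from x0 to x. When n >= 0, adding the generator j1 n times
gives a point of S with the forbidden defect at [(e x).1]: a contradiction.
Only finitely many points of S have to be considered, namely those below
[reach N], so n >= 0 holds for almost all x unless the point is a sink, that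
is, its signed defect at h tends to -oo. Sinks are dominated by the finitely many in
F, which x0 is chosen to make negative enough. The functionals that are
constant along U need n = 0, which is why x0 is taken typical for all of them
at once. *)
Lemma tame_directed (e : X -> E) :
    (\forall x \near U, [/\ gap_free (e x), directed (e x).1,
      eps%:~R * dot (d j1) (e x).1 = 1 & 0 < (e x).2 <= 1]) ->
  tame e.
Proof.
move=> eP; pose h x := floor_row (e x).1; pose fr x := frac_row (e x).1.
have dot_h u x : (idot u (h x))%:~R = dot u (e x).1 - dot u (fr x).
  by rewrite /fr dot_frac_row; lra.
have dot_fr u x : `|dot u (fr x)| <= (norm1_row u)%:~R := dot_frac_row_norm u _.
have h_ge0 : \forall x \near U, forall i, 0 <= h x 0 i.
  by apply: filterS eP => x [[e0 _] _ _ _] i; rewrite mxE floor_ge0.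
(* The signed defect of a sink tends to -oo along h; sinks are stable under
   increasing mu, and F b contains the minimal ones. *)
pose sink b := [set mu | tends_up U (fun x => - idot (eps *: defect_row b mu) (h x))].
have /choice[F FP] b : exists F : seq {ffun 'I_p -> nat}, {in F, forall mu, sink b mu} /\
    forall mu, sink b mu -> exists2 mu0, mu0 \in F & forall j, (mu0 j <= mu j)%N.
  by have [F F1 F2] := dickson (fun j mu => mu j) (sink b); exists F.
(* The margins norm1_row bound the contribution of the fractional part. *)
have x0P : \forall x0 \near U, [/\ forall i, 0 <= h x0 0 i,
    forall u, (exists k, \forall x \near U, idot u (h x) = k) ->
      \forall x \near U, idot u (h x) = idot u (h x0),
    forall j, tends_up U (fun x => idot (eps *: d j) (h x)) ->
      1 + norm1_row (d j) <= idot (eps *: d j) (h x0) &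
    forall b mu, mu \in F b ->
      1 + norm1_row (defect_row b mu) <= - idot (eps *: defect_row b mu) (h x0)].
  have near_d : \forall x0 \near U, forall j,
      tends_up U (fun x => idot (eps *: d j) (h x)) ->
      1 + norm1_row (d j) <= idot (eps *: d j) (h x0).
    apply: filter_forall => j.
    have [up|nup] := pselect (tends_up U (fun x => idot (eps *: d j) (h x))).
      by apply: filterS (up (1 + norm1_row (d j))).
    exact: nearW.
  have near_F : \forall x0 \near U, forall b mu, mu \in F b ->
      1 + norm1_row (defect_row b mu) <= - idot (eps *: defect_row b mu) (h x0).
    apply: filter_forall => b; apply: near_in_seq => mu muF.
    by have [/(_ mu muF) muS _] := FP b; apply: muS.
  have near_c := ultra_constant_functionals h UU.
  by near=> x0; split; near: x0.
have [x0 [h0_ge0 h0_const h0_d h0_F]] := filter_ex x0P.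
have h0_le : \forall x \near U, forall i, h x0 0 i <= h x 0 i.
  apply: filter_forall => i; have ipi h' := idot_delta i h'.
  have [cst|up|down] := ultra_int_trichotomy (fun x => idot (delta_mx 0 i) (h x)).
  - by apply: filterS (h0_const _ cst) => x; rewrite !ipi => ->.
  - by apply: filterS (up (h x0 0 i)) => x; rewrite ipi.
  - exfalso; apply: (@near_false _ U); apply: filterS2 h_ge0 (down 1) => x /(_ i).
    by rewrite ipi; lia.
pose N := (absz (\sum_i h x0 0 i)%R).+1.
pose l x : 'rV[rat]_m := fr x + map_mx intr (h x0).
have l_ge0 x i : 0 <= l x 0 i.
  rewrite /l mxE addr_ge0 //; first by case/andP: (frac_row_itv (e x).1 i).
  by rewrite mxE ler0z.
have l_le x i : `|l x 0 i| <= N%:R.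
  rewrite ger0_norm // /l mxE -natr1 addrC lerD //; last first.
    exact: le_trans (ler_norm _) (frac_row_norm _ i).
  rewrite mxE natr_absz ler_int (le_trans _ (ler_norm _)) // (bigD1 i) //= lerDl.
  by rewrite sumr_ge0.
have dot_l u x : dot u (l x) = dot u (e x).1 - (idot u (h x) - idot u (h x0))%:~R.
  by rewrite /l dotDr dot_int intrB (dot_h u x); lra.
have dot_l' u x : dot u (l x) = dot u (fr x) + (idot u (h x0))%:~R.
  by rewrite /l dotDr dot_int.
have eps_norm (a w : rat) : `|a| <= w -> `|eps%:~R * a| <= w.
  by rewrite normrM; case: epsP => ->; rewrite ?intrN ?normrN1 ?normr1 mul1r.
have l_dirJ : \forall x \near U, forall j, j \in J -> 1 <= eps%:~R * dot (d j) (l x).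
  apply: filter_forall => j; have [jJ|njJ] := boolP (j \in J); last exact: nearW.
  have ge1 : \forall x \near U, 1 <= eps%:~R * dot (d j) (e x).1.
    by apply: filterS eP => x [_ [dx _] _ _]; apply: dx.
  have [cst|up|down] := ultra_int_trichotomy (fun x => idot (eps *: d j) (h x)).
  - apply: filterS2 ge1 (h0_const _ cst) => x; rewrite !idotZl => ge1x.
    move=> /(congr1 (fun k => eps * k)); rewrite !mulrA.
    have -> : eps * eps = 1 by case: epsP => ->.
    by rewrite !mul1r dot_l => ->; rewrite subrr subr0.
  - apply: nearW => x _; have := h0_d j up; rewrite idotZl dot_l' mulrDr.
    rewrite -(ler_int rat) intrD intrM.
    have := eps_norm _ _ (dot_fr (d j) x); rewrite ler_norml => /andP[].
    by rewrite -[1%:~R]/(1 : rat); lra.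
  - exfalso; apply: (@near_false _ U).
    apply: filterS2 ge1 (down (norm1_row (d j))) => x ge1x.
    rewrite -(ler_int rat) idotZl intrN intrM dot_h mulrBr.
    have := eps_norm _ _ (dot_fr (d j) x); rewrite ler_norml => /andP[].
    by lra.
have l_dir0 : \forall x \near U, forall j, j \notin J -> dot (d j) (l x) = 0.
  apply: filter_forall => j; have [jJ|njJ] := boolP (j \in J); first exact: nearW.
  have eq0 : \forall x \near U, dot (d j) (e x).1 = 0.
    by apply: filterS eP => x [_ [_ dx] _ _]; apply: dx.
  have cst : exists k, \forall x \near U, idot (d j) (h x) = k.
    apply: (@ultra_int_bounded _ U _ _ (norm1_row (d j))); apply: filterS eq0 => x eq0x.
    by rewrite -(ler_int rat) intr_norm dot_h eq0x sub0r normrN.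
  by apply: filterS2 eq0 (h0_const _ cst) => x eq0x hE; rewrite dot_l hE eq0x subrr subr0.
have l_dir : \forall x \near U, directed (l x) by apply: filterS2 l_dirJ l_dir0.
pose mu_of (k : {ffun 'I_p -> 'I_(reach N)}) : {ffun 'I_p -> nat} := [ffun j => k j : nat].
have l_up : \forall x \near U, forall b k, ~ sink b (mu_of k) ->
    idot (eps *: defect_row b (mu_of k)) (h x0) <= idot (eps *: defect_row b (mu_of k)) (h x).
  apply: filter_forall => b; apply: filter_forall => k.
  have [cst|up|down] := ultra_int_trichotomy (fun x => idot (eps *: defect_row b (mu_of k)) (h x)).
  - by apply: filterS (h0_const _ cst) => x ->.
  - by apply: filterS (up (idot (eps *: defect_row b (mu_of k)) (h x0))).
  - by apply: nearW => x [].
have l_good : \forall x \near U, gap_free (l x, (e x).2).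
  apply: filterS3 eP l_dir l_up => x [[e0 gap] dx d1x /andP[s0 s1]] dl up.
  split=> [i|b mu] /=; first exact: l_ge0.
  rewrite -defect_trunc //.
  have [/existsP[j /andP[jJ muj]]|] := boolP [exists j in J, (reach N <= mu j)%N].
    by apply: sdefect_avoids => //; apply: (sdefect_far b (l_le x) dl jJ); rewrite ffunE jJ.
  rewrite negb_exists => /forallP lt_mu.
  have tr_lt j : (trunc_mult mu j < reach N)%N.
    by rewrite ffunE; have := lt_mu j; rewrite negb_and -ltnNge; case: ifP.
  pose k : {ffun 'I_p -> 'I_(reach N)} := [ffun j => Ordinal (tr_lt j)].
  have -> : trunc_mult mu = mu_of k by apply/ffunP => j; rewrite [RHS]ffunE [k j]ffunE.
  have [/(proj2 (FP b))[mu0 mu0F le_mu0]|/up] := pselect (sink b (mu_of k)).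
    apply: sdefect_avoids => //; apply: le_trans (sdefect_decr b dl le_mu0) _.
    have := h0_F b mu0 mu0F; rewrite idotZl -(ler_int rat) intrD intrN intrM.
    have := eps_norm _ _ (dot_fr (defect_row b mu0) x); rewrite ler_norml => /andP[].
    rewrite /defect dot_l' mulrDr -[1%:~R]/(1 : rat); lra.
  rewrite -subr_ge0; set n := (_ - _) => n_ge0.
  have := gap b [ffun i => (mu_of k i + (i == j1) * absz n)%N].
  rewrite defect_shift natr_absz ger0_norm // => gap1.
  suff -> : defect b (mu_of k) (l x) =
    defect b (mu_of k) (e x).1 - n%:~R * dot (d j1) (e x).1 by [].
  rewrite /defect dot_l; congr (_ - _).
  by rewrite /n !idotZl -mulrBr intrM -mulrA mulrCA d1x mulr1.
apply: (@tame_dominated l).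
  apply: filterS2 h0_le eP => x hx [[e0 _] _ _ _] i.
  rewrite /l mxE /fr /frac_row !mxE -addrA gerDl; have := hx i; rewrite /h !mxE.
  by rewrite -(ler_int rat); lra.
apply: (@tame_directed_bounded N).
apply: filterS3 eP l_dir l_good => x [ge _ _ /andP[s0 s1]] dl gl.
split=> //; split=> [i|]; first exact: l_le.
by rewrite ger0_norm ?(ltW s0) // (le_trans s1) // ler1n.
Unshelve. all: by end_near. Qed.

End OneSign.

(** Normalisation by the smallest nonzero |d_j|. The bound s <= 1 holds because,
from a point with a defect of sign eps, steps of length 1 towards the other
sign cannot jump over [0, s[ when s > 1. *)
Lemma tame_one_sign (eps : int) (J : {set 'I_p}) (j0 : 'I_p) (e : X -> E) :
    eps = 1 \/ eps = -1 -> j0 \in J ->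
    (\forall x \near U, [/\ gap_free (e x), 0 < (e x).2,
      forall j, j \in J -> 0 < eps%:~R * dot (d j) (e x).1,
      forall j, j \notin J -> dot (d j) (e x).1 = 0 &
      exists b mu, 0 <= eps%:~R * defect b mu (e x).1]) ->
  tame e.
Proof.
move=> epsP j0J eP; pose dl x j := eps%:~R * dot (d j) (e x).1.
have [j1 j1P] : exists j1, \forall x \near U,
    j1 \in J /\ forall j, j \in J -> dl x j1 <= dl x j.
  apply: ultra_finite; apply: nearW => x.
  by have [j jJ jmin] := @arg_minP _ _ _ j0 (mem J) (dl x) j0J; exists j.
have j1J : j1 \in J by have [x []] := filter_ex j1P.
pose t x := (dl x j1)^-1.
have t0 : \forall x \near U, 0 < t x.
  by apply: filterS eP => x [_ _ dJ _ _]; rewrite invr_gt0; apply: dJ.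
apply: (@tame_scale t) => //.
apply: (tame_directed epsP j1J).
apply: filterS3 t0 j1P eP => x tx0 [_ j1min] [ge e20 dJ dnJ [b [mu gap0]]].
have dj1 : eps%:~R * dot (d j1) (t x *: e x).1 = 1.
  by rewrite dotZr mulrCA mulVf // gt_eqF // dJ.
have gte := gap_freeZ tx0 ge.
split=> //.
  split=> j jJ; rewrite dotZr; last by rewrite dnJ ?mulr0.
  by rewrite mulrCA mulrC ler_pdivlMr ?dJ // mul1r j1min.
apply/andP; split; first exact: mulr_gt0.
have {}gap0 : 0 <= eps%:~R * defect b mu (t x *: e x).1.
  by rewrite /defect dotZr mulrCA pmulr_rge0.
move: gte dj1 gap0; move: (t x *: e x) => {ge e20 dJ dnJ j1min tx0} f [_ gap] dj1 gap0.
(* For eps = -1 the n-th step may stop just below 0, so one more is needed. *)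
pose n := Num.floor (eps%:~R * defect b mu f.1).
have n0 : 0 <= n by rewrite floor_ge0.
have := floor_itv (eps%:~R * defect b mu f.1); rewrite -/n intrD => /andP[n_le n_lt].
have nE : (absz n)%:R = n%:~R :> rat by rewrite natr_absz ger0_norm.
case: epsP gap0 dj1 n_le n_lt => ->; rewrite ?intrN ?mul1r ?mulN1r => gap0 dj1 n_le n_lt.
  have := gap b [ffun i => (mu i + (i == j1) * absz n)%N].
  by rewrite defect_shift nE dj1 mulr1 => /orP[]; lra.
have := gap b [ffun i => (mu i + (i == j1) * (absz n).+1)%N].
rewrite defect_shift -natr1 nE.
have -> : dot (d j1) f.1 = -1 by lra.
by move=> /orP[]; lra.
Qed.

(** When all [d j] are nonpositive and no base point has a negative defect, no
defect is ever negative; this case belongs with the one where all [d j]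
vanish, not with the one-sign case, because it puts no bound on s. *)
Lemma tame_gap_free (e : X -> E) : gap_region !=set0 ->
  (\forall x \near U, gap_free (e x)) -> tame e.
Proof.
move=> rne ge.
have [le0|gt0] := ultra_em (fun x => (e x).2 <= 0).
  by apply: tame_nonpos; apply: filterS2 ge le0 => x [].
have {}gt0 : \forall x \near U, 0 < (e x).2.
  by apply: filterS gt0 => x /negP; rewrite -ltNge.
have [Jp JpP] := ultra_set (fun j x => 0 < dot (d j) (e x).1).
have [Jn JnP] := ultra_set (fun j x => dot (d j) (e x).1 < 0).
have [Jp0|[j1 j1p]] := set_0Vmem Jp; have [Jn0|[j2 j2n]] := set_0Vmem Jn.
- apply: tame_bounded_below => //; near=> x.
  have d0 j : dot (d j) (e x).1 = 0.
    have : (j \in Jp) = (0 < dot (d j) (e x).1) by move: j; near: x.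
    have : (j \in Jn) = (dot (d j) (e x).1 < 0) by move: j; near: x.
    by rewrite Jp0 Jn0 !inE; case: ltgtP.
  split; [by near: x|by near: x|by move=> j; rewrite d0|by left].
- have [[b cb]|nc] := pselect (exists b, \forall x \near U, dot (c b) (e x).1 < 0).
    apply: (@tame_one_sign (-1) Jn j2) => //; first by right.
    near=> x.
    have dp j : (j \in Jp) = (0 < dot (d j) (e x).1) by move: j; near: x.
    have dn j : (j \in Jn) = (dot (d j) (e x).1 < 0) by move: j; near: x.
    split; [by near: x|by near: x| | |].
    + by move=> j; rewrite dn intrN mulN1r oppr_gt0.
    + move=> j; rewrite dn => /negbTE; have := dp j; rewrite Jp0 inE.
      by case: ltgtP.
    + exists b, [ffun=> 0%N]; rewrite defectE big1 => [|j _]; last first.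
        by rewrite ffunE mul0r.
      rewrite subr0 intrN mulN1r oppr_ge0 ltW //; near: x; exact: cb.
  have {}nc : \forall x \near U, forall b, 0 <= dot (c b) (e x).1.
    apply: filter_forall => b.
    have [cb|ncb] := ultra_em (fun x => dot (c b) (e x).1 < 0).
      by case: nc; exists b.
    by apply: filterS ncb => x /negP; rewrite -leNgt.
  apply: tame_bounded_below => //; near=> x.
  have dp j : (j \in Jp) = (0 < dot (d j) (e x).1) by move: j; near: x.
  split; [by near: x|by near: x| |by right; near: x].
  by move=> j; have := dp j; rewrite Jp0 inE; case: ltP.
- apply: (@tame_one_sign 1 Jp j1) => //; first by left.
  near=> x.
  have dp j : (j \in Jp) = (0 < dot (d j) (e x).1) by move: j; near: x.
  have dn j : (j \in Jn) = (dot (d j) (e x).1 < 0) by move: j; near: x.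
  have gx : gap_free (e x) by near: x.
  split; [by []|by near: x| | |].
  + by move=> j; rewrite dp mul1r.
  + move=> j; rewrite dp => /negbTE; have := dn j; rewrite Jn0 inE.
    by case: ltgtP.
  + by have [b [mu]] := defect_ge0_exists rne gx.1; exists b, mu; rewrite mul1r.
- apply: (@tame_mixed e j1 j2) => //; near=> x.
  have dp j : (j \in Jp) = (0 < dot (d j) (e x).1) by move: j; near: x.
  have dn j : (j \in Jn) = (dot (d j) (e x).1 < 0) by move: j; near: x.
  by split; [near: x|near: x|rewrite -dp|rewrite -dn].
Unshelve. all: by end_near. Qed.

End Local.

Lemma gap_region_finite :
  exists F : seq E, gap_region = [set y | {in F, forall f, 0 <= slack y f}].
Proof.
have [rne|r0] := pselect (gap_region !=set0); last first.
  exists [:: (0, 1)]; apply/seteqP; split=> [y yR|y /(_ (0, 1))].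
    by case: r0; exists y.
  rewrite inE eqxx => /(_ isT); rewrite /slack big1 => [|i _].
    by rewrite sub0r rmorph1 oppr_ge0 ler10.
  by rewrite mxE rmorph0 mul0r.
pose C := [set A | exists2 F : seq E, {in F, forall f, valid f} &
  A = [set e | implied F e]].
have [|||_ [F Fv ->] FP] := @ultra_cover E [set e | gap_free e] C.
- by exists [set e | implied [::] e], [::].
- move=> _ _ [F Fv ->] [F' F'v ->]; exists [set e | implied (F ++ F') e].
    by exists (F ++ F') => // f; rewrite mem_cat => /orP[/Fv|/F'v].
  move=> e [eF|eF] y yF; apply: eF => f fF; apply: yF.
    by rewrite mem_cat fF.
  by rewrite mem_cat fF orbT.
- move=> U UU Ug; have [|F Fv FU] := @tame_gap_free E U UU id rne; first exact: Ug.
  by exists [set e | implied F e] => //; exists F.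
- exists F; apply/seteqP; split=> y yP; last by move=> e /FP; apply.
  by move=> f /Fv; apply.
Qed.

End Core.

(** * Integer points of a rational polyhedron *)

Section IntegerPoints.
Variables (n k : nat) (A : 'M[int]_(k, n)) (b : 'cV[int]_k).
Implicit Types z r : 'cV[int]_n.

Definition nat_part (a : int) : nat := if 0 <= a then absz a else 0%N.

(** The positive and negative parts of the entries and the slacks: when all of
them are smaller at y than at z, the difference z - y lies in the same orthant
as z and in the recession cone. *)
Definition conformal_coord (s : ('I_n + 'I_n) + 'I_k) z : nat :=
  match s with
  | inl (inl i) => nat_part (z i 0)
  | inl (inr i) => nat_part (- z i 0)
  | inr i => nat_part ((b - A *m z) i 0)
  end.

Definition conformal_le z z' := forall i, (nat_part (z i 0)%R <= nat_part (z' i 0)%R)%N /\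
  (nat_part (- z i 0)%R <= nat_part (- z' i 0)%R)%N.

Definition norm1 z : nat := (\sum_i absz (z i 0)%R)%N.

Lemma norm1B z z' : conformal_le z z' -> (norm1 (z' - z)%R + norm1 z = norm1 z')%N.
Proof.
move=> zz'; rewrite -big_split; apply: eq_bigr => i _; rewrite !mxE.
have [] := zz' i; rewrite /nat_part; do ![case: ifP] => /=; lia.
Qed.

Lemma conformal_dickson (G : set 'cV[int]_n) :
    (forall z, G z -> forall i, (A *m z) i 0 <= b i 0) ->
  exists2 F : seq 'cV[int]_n, {in F, forall z, G z} & forall z, G z ->
    exists2 y, y \in F & conformal_le y z /\ forall i, (A *m (z - y)) i 0 <= 0.
Proof.
move=> GA; have [F FG FP] := dickson conformal_coord G; exists F => // z Gz.
have [y yF yz] := FP z Gz; exists y => //; split=> i.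
  by split; [apply: (yz (inl (inl i)))|apply: (yz (inl (inr i)))].
have BE (v w : 'cV[int]_k) : (v - w) i 0 = v i 0 - w i 0 by rewrite !mxE.
have := yz (inr i); rewrite /= /nat_part mulmxBr !BE.
have := GA z Gz i; have := GA y (FG y yF) i.
move: ((A *m y) i 0) ((A *m z) i 0) (b i 0) => ay az bi.
by do ![case: ifP] => /=; lia.
Qed.

End IntegerPoints.

(** Generators are the minimal nonzero vectors for the conformal order; removing
one of them from a vector of the cone decreases the l1 norm. *)
Lemma recession_monoid n k (A : 'M[int]_(k, n)) :
  exists p (G : 'I_p -> 'cV[int]_n), forall r : 'cV[int]_n,
    (forall i, (A *m r) i 0 <= 0) <->
    exists mu : {ffun 'I_p -> nat}, r = \sum_j G j *+ mu j.
Proof.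
pose M := [set r : 'cV[int]_n | r != 0 /\ forall i, (A *m r) i 0 <= 0].
have [|F FM FP] := @conformal_dickson n k A 0 M.
  by move=> r [_ rA] i; rewrite [leRHS]mxE.
exists (size F), (fun j => F`_j) => r; split; last first.
  move=> [mu ->] i; rewrite mulmx_sumr summxE sumr_le0 // => j _.
  rewrite -scaler_nat -scalemxAr mxE mulr_ge0_le0 //.
  by have [_] : M F`_j by apply: FM; apply: mem_nth.
have [s] := ubnP (norm1 r); elim: s r => // s IHs r rs rA.
have [->|r0] := eqVneq r 0.
  by exists [ffun=> 0%N]; rewrite big1 // => j _; rewrite ffunE mulr0n.
have [y yF [yr rAy]] := FP r (conj r0 rA).
have [y0 _] := FM y yF.
have y_gt0 : (0 < norm1 y)%N.
  rewrite lt0n; apply: contra y0; rewrite /norm1 sum_nat_eq0 => /forallP y0.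
  by apply/eqP/colP => i; have := y0 i; rewrite !mxE absz_eq0 => /eqP.
have [|mu muE] := IHs (r - y) _ rAy.
  by have := norm1B yr; lia.
have lt_y : (index y F < size F)%N by rewrite index_mem.
exists [ffun j => (mu j + (j == Ordinal lt_y))%N].
rewrite -[LHS](subrK y) muE (bigD1 (Ordinal lt_y)) //= [in RHS](bigD1 (Ordinal lt_y)) //=.
rewrite ffunE eqxx mulrnDr nth_index // mulr1n addrAC; congr (_ + _).
by apply: eq_bigr => j /negbTE jy; rewrite ffunE jy addn0.
Qed.

Lemma integer_points_decomposition n k (A : 'M[int]_(k, n)) (b : 'cV[int]_k) :
  exists q (B : 'I_q -> 'cV[int]_n) p (G : 'I_p -> 'cV[int]_n),
    forall z : 'cV[int]_n, (forall i, (A *m z) i 0 <= b i 0) <->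
    exists a (mu : {ffun 'I_p -> nat}), z = B a + \sum_j G j *+ mu j.
Proof.
have [p [G GP]] := recession_monoid A.
have [//|F FM FP] := @conformal_dickson n k A b [set z | forall i, (A *m z) i 0 <= b i 0].
exists (size F), (fun a => F`_a), p, G => z; split=> [Az|[a [mu ->]] i].
  have [y yF [_ /GP[mu muE]]] := FP z Az.
  have lt_y : (index y F < size F)%N by rewrite index_mem.
  by exists (Ordinal lt_y), mu; rewrite -muE nth_index // addrC subrK.
rewrite mulmxDr mxE -[leRHS]addr0 lerD //; first by apply: FM; apply: mem_nth.
by apply: (proj2 (GP _)); exists mu.
Qed.

(** * Rational multipliers *)

Section RationalMultipliers.
Variables (R : realType) (m n : nat) (A : 'M[int]_(m, n)).

(** Caratheodory's argument: along a linear relation between the rows in the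
support, one can move until an entry of the multiplier vanishes. *)
Lemma minimal_support_free (l : 'rV[R]_m) : (forall i, 0 <= l 0 i) ->
  exists2 l' : 'rV[R]_m, [/\ forall i, 0 <= l' 0 i, forall i, l 0 i = 0 -> l' 0 i = 0 &
      l' *m toReal R A = l *m toReal R A] &
    forall k : 'rV[R]_m, (forall i, l' 0 i = 0 -> k 0 i = 0) ->
      k *m toReal R A = 0 -> k = 0.
Proof.
pose supp (v : 'rV[R]_m) := [set i | v 0 i != 0]%SET.
have [s] := ubnP #|supp l|; elim: s l => // s IHs l ls l0.
have [|/existsNP[k /not_implyP[k_l /not_implyP[kA /eqP k0]]]] := pselect
    (forall k : 'rV[R]_m, (forall i, l 0 i = 0 -> k 0 i = 0) ->
      k *m toReal R A = 0 -> k = 0); first by exists l.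
wlog [i0 ki0] : k k_l kA k0 / exists i, 0 < k 0 i.
  move=> hwlog; have [//|nk] := pselect (exists i, 0 < k 0 i); first exact: (hwlog k).
  apply: (hwlog (- k)); rewrite ?oppr_eq0 //; [move=> i li| |].
  - by rewrite mxE k_l ?oppr0.
  - by rewrite mulNmx kA oppr0.
  - have [i ki] : exists i, k 0 i != 0.
      apply: contrapT => /forallNP kk; case/eqP: k0; apply/rowP => i; rewrite mxE.
      by have /negP := kk i; rewrite negbK => /eqP.
    exists i; rewrite mxE oppr_gt0 lt_neqAle ki leNgt; apply/negP => kgt.
    by apply: nk; exists i.
have [i ki imin] := @arg_minP _ _ _ i0 (fun i => 0 < k 0 i) (fun i => l 0 i / k 0 i) ki0.
set t := l 0 i / k 0 i in imin.
have t0 : 0 <= t by rewrite divr_ge0 // ltW.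
have l'0 j : 0 <= (l - t *: k) 0 j.
  rewrite !mxE subr_ge0; have [kj|kj] := ltP 0 (k 0 j).
    by rewrite -ler_pdivlMr // imin.
  by rewrite (@le_trans _ _ 0) // mulr_ge0_le0.
have [|l' [l'p l'l l'A] l'P] := IHs (l - t *: k) _ l'0.
  rewrite -ltnS; apply: leq_trans ls; rewrite ltnS; apply: proper_card; apply/properP.
  split.
    apply/fintype.subsetP => j; rewrite !inE; apply: contra => /eqP lj.
    by rewrite !mxE lj k_l // mulr0 subrr.
  exists i; rewrite !inE.
    by apply: contraTneq ki => /k_l ->; rewrite ltxx.
  by rewrite negbK !mxE /t divfK ?subrr // gt_eqF.
exists l' => //; split=> // [j lj|].
  by apply: l'l; rewrite !mxE lj k_l // mulr0 subrr.
by rewrite l'A mulmxBl -scalemxAl kA scaler0 subr0.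
Qed.

(** Over a support with independent rows the multiplier is the only solution of a
rational linear system. That system is solvable over the reals, hence over the
rationals, so the multiplier is rational. *)
Lemma rational_multipliers (l : 'rV[R]_m) (alpha : 'rV[int]_n) :
    (forall i, 0 <= l 0 i) -> toReal R alpha = l *m toReal R A ->
  exists2 l' : 'rV[rat]_m,
    (forall i, 0 <= l' 0 i) /\ (forall i, l 0 i = 0 -> l' 0 i = 0) &
    map_mx intr alpha = l' *m map_mx intr A.
Proof.
move=> l0 lA; have [l1 [l1p l1l l1A] l1P] := minimal_support_free l0.
pose S (F : fieldType) : 'M[F]_m := diag_mx (\row_i (l1 0 i != 0)%:R).
have ratA k1 k2 (M : 'M[int]_(k1, k2)) : toReal R M = map_mx ratr (map_mx intr M : 'M[rat]_(k1, k2)).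
  by apply/matrixP => i j; rewrite !mxE ratr_int.
have ratS : S R = map_mx ratr (S rat).
  by apply/matrixP => i j; rewrite !mxE rmorphMn /= rmorph_nat.
have l1S : l1 *m S R = l1.
  apply/rowP => i; rewrite mul_mx_diag !mxE.
  by have [->|] := eqVneq (l1 0 i) 0; rewrite ?mul0r ?mulr1.
have /submxP[D DE] : ((map_mx intr alpha : 'rV[rat]_n) <= S rat *m map_mx intr A)%MS.
  rewrite -(map_submx (ratr : rat -> R)) map_mxM -ratS -!ratA lA -l1A -{1}l1S -mulmxA.
  exact: submxMl.
pose l' := D *m S rat.
have l'E : map_mx ratr l' = l1.
  apply/eqP; rewrite -subr_eq0; apply/eqP; apply: l1P.
    move=> i l1i; have l'i : l' 0 i = 0.
      by rewrite /l' mul_mx_diag 2!mxE l1i eqxx mulr0.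
    have BE (v w : 'rV[R]_m) : (v - w) 0 i = v 0 i - w 0 i by rewrite !mxE.
    by rewrite BE [map_mx _ l' 0 i]mxE l'i l1i rmorph0 subr0.
  by rewrite mulmxBl l1A -lA ratA [toReal R alpha]ratA -map_mxM DE mulmxA subrr.
have l'i i : ratr (l' 0 i) = l1 0 i.
  by have /rowP/(_ i) := l'E; rewrite [LHS]mxE.
exists l'; last by rewrite DE mulmxA.
split=> i; first by rewrite -(ler_rat R) rmorph0 l'i.
by move=> /l1l; rewrite -l'i => /eqP; rewrite fmorph_eq0 => /eqP.
Qed.

End RationalMultipliers.

(** * Finite intersections of rational half-spaces *)

Section RationalPolyhedra.
Variables (R : realType) (n : nat).

Lemma rational_polyhedron_setT : rational_polyhedron (@setT 'cV[R]_n).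
Proof.
exists 0%N, 0, 0; apply/seteqP; split=> // x _ []; by [].
Qed.

Lemma rational_polyhedronI (P Q : set 'cV[R]_n) :
  rational_polyhedron P -> rational_polyhedron Q -> rational_polyhedron (P `&` Q).
Proof.
move=> [m1 [A1 [b1 ->]]] [m2 [A2 [b2 ->]]].
exists (m1 + m2)%N, (col_mx A1 A2), (col_mx b1 b2); rewrite /polyhedron.
rewrite map_col_mx; apply/seteqP; split=> x; rewrite /= mul_col_mx.
  move=> [x1 x2] i; case: (splitP i) => j ij.
    by rewrite (_ : i = lshift m2 j) ?col_mxEu //; apply: val_inj.
  by rewrite (_ : i = rshift m1 j) ?col_mxEd //; apply: val_inj.
move=> xi; split=> i.
  by have := xi (lshift m2 i); rewrite !col_mxEu.
by have := xi (rshift m1 i); rewrite !col_mxEd.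
Qed.

Lemma rational_polyhedron_bigcap (T : eqType) (s : seq T) (P : T -> set 'cV[R]_n) :
  (forall t, t \in s -> rational_polyhedron (P t)) ->
  rational_polyhedron [set x | forall t, t \in s -> P t x].
Proof.
elim: s => [|t s IHs] sP.
  have -> : [set x | forall t, t \in [::] -> P t x] = setT by apply/seteqP.
  exact: rational_polyhedron_setT.
have -> : [set x | forall t', t' \in t :: s -> P t' x] =
    P t `&` [set x | forall t', t' \in s -> P t' x].
  apply/seteqP; split=> [x xP|x [Px xP] t'].
    split=> [|t' t's]; apply: xP; first exact: mem_head.
    by rewrite inE t's orbT.
  by rewrite inE => /orP[/eqP->|/xP].
apply: rational_polyhedronI; first by apply: sP; apply: mem_head.
by apply: IHs => t' t's; apply: sP; rewrite inE t's orbT.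
Qed.

Lemma rational_polyhedron_halfspace (a : 'rV[int]_n) (k : int) :
  rational_polyhedron [set x : 'cV[R]_n | (toReal R a *m x) 0 0 <= k%:~R].
Proof.
exists 1%N, a, (const_mx k).
have kE i : (const_mx k : 'cV[int]_1) i 0 = k by rewrite mxE.
apply/seteqP; split=> x /=; last by move=> /(_ 0); rewrite kE.
by move=> xk i; rewrite kE ord1.
Qed.

End RationalPolyhedra.

(** * The closure as an intersection of gap regions *)

Lemma S_floorP (R : realType) n (S : set 'cV[int]_n) (alpha : 'rV[int]_n) (beta : R) :
  S_values S alpha beta !=set0 ->
  maxima (S_values S alpha beta) (S_floor S alpha beta).
Proof.
move=> [v Vv]; apply: xgetPex.
have Vle w : S_values S alpha beta w -> w <= Num.floor beta.
  by move=> [z [_ zb] <-]; rewrite floor_ge_int.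
have exk : exists k, `[< S_values S alpha beta (Num.floor beta - k%:Z) >].
  exists (absz (Num.floor beta - v)); apply/asboolP.
  by rewrite gez0_abs ?subr_ge0 ?Vle // subKr.
case: (ex_minnP exk) => k /asboolP Vk kmin; exists (Num.floor beta - k%:Z).
split=> // w Vw; have wle := Vle w Vw.
have := kmin (absz (Num.floor beta - w)); rewrite gez0_abs ?subr_ge0 // subKr.
by move=> /(_ (asboolT Vw)); lia.
Qed.

Section Closure.
Variables (R : realType) (n m : nat) (A : 'M[int]_(m, n)) (b : 'cV[int]_m).
Variables (S : set 'cV[int]_n) (q p : nat).
Variables (B : 'I_q -> 'cV[int]_n) (G : 'I_p -> 'cV[int]_n).
Hypothesis SP : forall z, S z <->
  exists a (mu : {ffun 'I_p -> nat}), z = B a + \sum_j G j *+ mu j.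

Implicit Types (T : {set 'I_m}) (x : 'cV[R]_n) (z : 'cV[int]_n).

(** Rows outside T are replaced by zero rather than removed, so that multipliers
keep the same index set for all T. *)
Definition keep_rows T (v : 'cV[int]_m) : 'rV[int]_m := \row_i (if i \in T then v i 0 else 0).

Lemma keep_rowsD T u v : keep_rows T (u + v) = keep_rows T u + keep_rows T v.
Proof. by apply/rowP => i; rewrite !mxE; case: ifP; rewrite ?addr0. Qed.

Lemma keep_rowsB T u v : keep_rows T (u - v) = keep_rows T u - keep_rows T v.
Proof. by apply/rowP => i; rewrite !mxE; case: ifP; rewrite ?subrr. Qed.

Lemma keep_rows0 T : keep_rows T 0 = 0.
Proof. by apply/rowP => i; rewrite !mxE if_same. Qed.

Definition base_defects T a := keep_rows T (b - A *m B a).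
Definition ray_defects T j := keep_rows T (A *m G j).

Definition residual T x : 'rV[R]_m :=
  \row_i (if i \in T then (b i 0)%:~R - (toReal R A *m x) i 0 else 0).

Definition tight_set T := exists2 x, polyhedron R A b x &
  forall i, i \in T -> (toReal R A *m x) i 0 = (b i 0)%:~R.

Lemma defect_residual T a (mu : {ffun 'I_p -> nat}) (l : 'rV[rat]_m) :
  ratr (defect (base_defects T) (ray_defects T) a mu l) =
  \sum_i ratr (l 0 i) * residual T (toReal R (B a + \sum_j G j *+ mu j)) 0 i.
Proof.
rewrite /defect /defect_row; set z := B a + _.
have -> : base_defects T a - \sum_j ray_defects T j *+ mu j = keep_rows T (b - A *m z).
  rewrite /z mulmxDr mulmx_sumr opprD addrA keep_rowsB; congr (_ - _).
  rewrite (big_morph _ (keep_rowsD T) (keep_rows0 T)); apply: eq_bigr => j _.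
  elim: (mu j) => [|k IHk]; first by rewrite !mulr0n mulmx0 keep_rows0.
  by rewrite !mulrS mulmxDr keep_rowsD IHk.
rewrite /dot rmorph_sum; apply: eq_bigr => i _; rewrite rmorphM /= ratr_int.
have AzE : (toReal R A *m toReal R z) i 0 = ((A *m z) i 0)%:~R.
  by rewrite -map_mxM mxE.
have bE : (b - A *m z) i 0 = b i 0 - (A *m z) i 0 by rewrite !mxE.
rewrite [keep_rows _ _ _ _]mxE [residual _ _ _ _]mxE AzE bE.
by case: ifP => _ //; rewrite rmorphB.
Qed.

Lemma sum_residual T x (l : 'rV[R]_m) : (forall i, i \notin T -> l 0 i = 0) ->
  \sum_i l 0 i * residual T x 0 i = (l *m toReal R b) 0 0 - (l *m toReal R A *m x) 0 0.
Proof.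
move=> l0; rewrite -mulmxA mxE [X in _ - X]mxE -sumrB; apply: eq_bigr => i _.
rewrite [residual _ _ _ _]mxE [toReal R b i 0]mxE -mulrBr.
by case: ifPn => // /l0->; rewrite !mul0r.
Qed.

Lemma rational_polyhedron_slack T (l : 'rV[rat]_m) (s : rat) :
  rational_polyhedron [set x | 0 <= slack (residual T x) (l, s : rat^o)].
Proof.
have [N N0 [z zP]] := common_denominator (fun i : option 'I_m => oapp (l 0) s i).
have NR0 : (0 : R) < N%:R by rewrite ltr0n.
pose w : 'rV[int]_m := \row_i (if i \in T then z (Some i) else 0).
have -> : [set x | 0 <= slack (residual T x) (l, s : rat^o)] =
    [set x | (toReal R (w *m A) *m x) 0 0 <= ((w *m b) 0 0 - z None)%:~R].
  apply/seteqP; suff xE x : 0 <= slack (residual T x) (l, s : rat^o) =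
      ((toReal R (w *m A) *m x) 0 0 <= ((w *m b) 0 0 - z None)%:~R).
    by split=> x /=; rewrite xE.
  rewrite -(pmulr_rge0 _ NR0) /slack /= mulrBr mulr_sumr.
  have -> : N%:R * ratr s = (z None)%:~R :> R.
    by rewrite -(ratr_nat R) -rmorphM (zP None) /= ratr_int.
  have -> : \sum_i N%:R * (ratr (l 0 i) * residual T x 0 i) =
      \sum_i toReal R w 0 i * residual T x 0 i.
    apply: eq_bigr => i _; rewrite !mxE mulrA.
    case: ifP => _; rewrite ?mulr0 //; congr (_ * _).
    by rewrite -(ratr_nat R) -rmorphM (zP (Some i)) /= ratr_int.
  rewrite sum_residual => [|i /negbTE iT]; last by rewrite !mxE iT.
  rewrite map_mxM -map_mxM rmorphB /= -map_mxM [map_mx _ (w *m b) 0 0]mxE.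
  by rewrite !subr_ge0 lerBrDr lerBrDr addrC.
exact: rational_polyhedron_halfspace.
Qed.

(** From left to right, a gap-free multiplier supported on a tight T is cleared of
its denominators and yields a pair of Pi, whose cut implies the inequality.
From right to left, T is the tight set of a point where the maximum is
attained; the defect of the point of S that gives the floor is the largest s
that makes the rational multiplier gap-free. *)
Lemma SCG_closureE : SCG_closure R S A b =
  [set x | forall T, tight_set T -> gap_region (base_defects T) (ray_defects T) (residual T x)].
Proof.
apply/seteqP; split=> [x xS T [xT PxT xTb] [l s] [l0 gap]|x xT [alpha beta]].
  have [N N0 [z zP]] := common_denominator (fun i => l 0 i).
  have NR0 : (0 : R) < N%:R by rewrite ltr0n.
  pose w : 'rV[int]_m := \row_i (if i \in T then z i else 0).
  have wT i : i \notin T -> toReal R w 0 i = 0.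
    by move=> /negbTE iT; rewrite !mxE iT.
  have w0 i : 0 <= toReal R w 0 i.
    rewrite !mxE ler0z; case: ifP => // _.
    by rewrite -(ler0z rat) -zP mulr_ge0 // ler0n.
  have wl y : N%:R * \sum_i ratr (l 0 i) * residual T y 0 i =
      \sum_i toReal R w 0 i * residual T y 0 i.
    rewrite mulr_sumr; apply: eq_bigr => i _; rewrite !mxE mulrA.
    case: ifP => _; rewrite ?mulr0 //; congr (_ * _).
    by rewrite -(ratr_nat R) -rmorphM zP /= ratr_int.
  have Pip : Pi R A b (w *m A, (toReal R w *m toReal R b) 0 0).
    exists (toReal R w); split=> //=; first by rewrite map_mxM.
    have wE y : (toReal R w *m toReal R A *m y) 0 0 =
        (toReal R w *m toReal R b) 0 0 - \sum_i toReal R w 0 i * residual T y 0 i.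
      by rewrite sum_residual // subKr.
    split.
      exists xT => //; rewrite wE big1 ?subr0 // => i _.
      by rewrite [residual _ _ _ _]mxE; case: ifP => [/xTb->|]; rewrite ?subrr mulr0.
    move=> _ [y Py <-]; rewrite wE gerBl sumr_ge0 // => i _; rewrite mulr_ge0 //.
    by rewrite [residual _ _ _ _]mxE; case: ifP => // _; rewrite subr_ge0.
  have [/S_floorP[[z0 [/SP[a [mu ->]] z0b] z0E] _] xcut] := xS _ Pip.
  rewrite -z0E /= in xcut z0b.
  have gapE : (N%:R * defect (base_defects T) (ray_defects T) a mu l : rat) =
    (((w *m b) 0 0 - (w *m A *m (B a + \sum_j G j *+ mu j)) 0 0)%:~R).
    apply: (fmorph_inj (ratr : rat -> R)).
    rewrite rmorphM /= ratr_nat defect_residual wl sum_residual // ratr_int.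
    by rewrite -!map_mxM [map_mx _ _ 0 0]mxE [X in _ - X]mxE rmorphB.
  have N0' : (0 : rat) < N%:R by rewrite ltr0n.
  have gap0 : 0 <= defect (base_defects T) (ray_defects T) a mu l.
    rewrite -(pmulr_rge0 _ N0') gapE ler0z subr_ge0 -(ler_int R).
    by move: z0b; rewrite -map_mxM [map_mx _ _ 0 0]mxE.
  have := gap a mu; rewrite ltNge gap0 /= => s_le.
  rewrite /slack /= subr_ge0 -(ler_pM2l NR0) wl sum_residual //.
  apply: (@le_trans _ _ (ratr (N%:R * defect (base_defects T) (ray_defects T) a mu l))).
    by rewrite rmorphM /= ratr_nat ler_pM2l // ler_rat.
  rewrite gapE ratr_int rmorphB /= -[toReal R w *m toReal R b]map_mxM.
  rewrite [map_mx _ _ 0 0]mxE lerD2l lerN2.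
  by move: xcut; rewrite map_mxM.
move=> [l [l0 lA lb [[xm Pxm xmE] ub]]]; rewrite /= in lA lb xmE ub *.
pose T := [set i | (toReal R A *m xm) i 0 == (b i 0)%:~R]%SET.
have tT : tight_set T by exists xm => // i; rewrite inE => /eqP.
have lT i : i \notin T -> l 0 i = 0.
  move: lb; rewrite -xmE -mulmxA mxE [RHS]mxE => /eqP.
  rewrite eq_sym -subr_eq0 -sumrB psumr_eq0 => [/allP/(_ i (mem_index_enum i))|k _].
    rewrite -mulrBr mulf_eq0 => /orP[/eqP//|]; rewrite mxE subr_eq0 inE => /eqP->.
    by rewrite eqxx.
  by rewrite -mulrBr mulr_ge0 // subr_ge0 [toReal R b k 0]mxE.
have [l' [l'0 l'l] l'A] := rational_multipliers l0 lA.
have ratrE k1 k2 (M : 'M[int]_(k1, k2)) :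
    toReal R M = map_mx ratr (map_mx intr M : 'M[rat]_(k1, k2)).
  by apply/matrixP => i j; rewrite !mxE ratr_int.
have l'T i : i \notin T -> map_mx (ratr : rat -> R) l' 0 i = 0.
  by move=> /lT/l'l li; rewrite mxE li rmorph0.
have l'AR : map_mx ratr l' *m toReal R A = toReal R alpha.
  by rewrite !ratrE -map_mxM -l'A.
have l'b : (map_mx ratr l' *m toReal R b) 0 0 = beta.
  have := sum_residual xm l'T; rewrite big1 => [|i _]; last first.
    by rewrite [residual _ _ _ _]mxE inE; case: eqP => [->|]; rewrite ?subrr mulr0.
  by move=> /esym/eqP; rewrite subr_eq0 l'AR lA xmE => /eqP.
have res y : \sum_i ratr (l' 0 i) * residual T y 0 i = beta - (toReal R alpha *m y) 0 0.
  by rewrite -l'b -l'AR -(sum_residual y l'T); apply: eq_bigr => i _; rewrite [map_mx _ _ 0 i]mxE.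
have alphaE z : (toReal R alpha *m toReal R z) 0 0 = ((alpha *m z) 0 0)%:~R.
  by rewrite -map_mxM mxE.
have gapE a mu : ratr (defect (base_defects T) (ray_defects T) a mu l') =
    beta - ((alpha *m (B a + \sum_j G j *+ mu j)) 0 0)%:~R.
  by rewrite defect_residual res alphaE.
have Sne : S_values S alpha beta !=set0.
  have [|a [mu gap0]] := @defect_ge0_exists R m q p (base_defects T) (ray_defects T) l' _ l'0.
    by exists (residual T x); exact: xT.
  exists ((alpha *m (B a + \sum_j G j *+ mu j)) 0 0).
  exists (B a + \sum_j G j *+ mu j) => //; split; first by apply/SP; exists a, mu.
  by rewrite -subr_ge0 -gapE ler0q.
split=> //; have [[z [/SP[a [mu zE]] zb] <-] zmax] := S_floorP Sne.
pose s := defect (base_defects T) (ray_defects T) a mu l'.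
have gs : gap_free (base_defects T) (ray_defects T) (l', s).
  split=> // a' mu' /=; case: ltP => //= gap0.
  rewrite -(ler_rat R) !gapE lerD2l lerN2 -zE ler_int; apply: zmax.
  exists (B a' + \sum_j G j *+ mu' j) => //; split; first by apply/SP; exists a', mu'.
  by rewrite -subr_ge0 -gapE ler0q.
have := xT T tT _ gs; rewrite /slack /= res gapE -zE.
by rewrite subr_ge0 lerD2l lerN2.
Qed.

End Closure.

Theorem theorem1p1 (R : realType) (n : nat) (Q : set 'cV[R]_n)
    (hQ : rational_polyhedron Q)
    (S : set 'cV[int]_n) (hS : S = integer_points Q)
    (m : nat) (A : 'M[int]_(m, n)) (b : 'cV[int]_m)
    (hP0 : polyhedron R A b !=set0)
    (hP : polyhedron R A b `<=` convex_hull R S) :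
  rational_polyhedron (SCG_closure R S A b).
Proof.
case: hQ hS => k [A' [b' ->]] SE.
have [q [B [p [G BGP]]]] := integer_points_decomposition A' b'.
have SP z : S z <-> exists a (mu : {ffun 'I_p -> nat}), z = B a + \sum_j G j *+ mu j.
  rewrite -BGP SE /integer_points /polyhedron /= -map_mxM.
  by split=> zP i; have := zP i; rewrite [map_mx _ _ i 0]mxE ler_int.
rewrite (SCG_closureE R A b SP).
pose tights := [seq T <- enum {set 'I_m} | `[< tight_set R A b T >]].
have -> : [set x : 'cV[R]_n | forall T, tight_set R A b T ->
      gap_region (base_defects A b B T) (ray_defects A G T) (residual A b T x)] =
    [set x | forall T, T \in tights ->
      gap_region (base_defects A b B T) (ray_defects A G T) (residual A b T x)].
  apply/seteqP; split=> x xT T.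
    by rewrite mem_filter => /andP[/asboolP/xT].
  by move=> tT; apply: xT; rewrite mem_filter mem_enum andbT; apply/asboolP.
apply: rational_polyhedron_bigcap => T _.
have [F ->] := gap_region_finite R (base_defects A b B T) (ray_defects A G T).
apply: (@rational_polyhedron_bigcap _ _ _ F (fun f => [set x | 0 <= slack (residual A b T x) f])).
move=> [l s] _; exact: rational_polyhedron_slack.
Qed.
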